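(* Let $\mathbb K^a$ ($a\ge0$), $\mathbb K^{\rm P}$ and $\mathbb K^{\rm Ai}$ denote the transition kernel with parameter $a$, the extended Pearcey kernel and the extended Airy kernel. Then $\mathbb K^0=\mathbb K^{\rm P}$, and for any $u,v,\tau_1,\tau_2\in\mathbb R$ $$\lim_{a\to+\infty}a^{1/3}\,\mathbb K^a_{2a^{2/3}\tau_1,\,2a^{2/3}\tau_2}(a^{1/3}u,a^{1/3}v)=\mathbb K^{\rm Ai}_{\tau_1,\tau_2}(u,v).$$
   Context: For $\tau_1,\tau_2,u,v\in\mathbb R$: Extended Airy kernel: $$\mathbb K^{\rm Ai}_{\tau_1,\tau_2}(u,v):=\frac1{(2\pi i)^2}\int_{\Sigma^{\rm Ai}}d\zeta\int_{\Gamma^{\rm Ai}}d\omega\,\frac{\exp(\frac{\zeta^3}3-\zeta v-\tau_2\zeta^2-\frac{\omega^3}3+\omega u+\tau_1\omega^2)}{\zeta-\omega}-1(\tau_1>\tau_2)\frac{\exp(-\frac{(u-v)^2}{4(\tau_1-\tau_2)})}{\sqrt{4\pi(\tau_1-\tau_2)}},$$ where $\Sigma^{\rm Ai}$ consists of the rays from $\infty e^{-i\pi/3}$ to $0$ and from $0$ to $\infty e^{i\pi/3}$, and $\Gamma^{\rm Ai}$ of the rays from $\infty e^{-2i\pi/3}$ to $0$ and from $0$ to $\infty e^{2i\pi/3}$. Extended Pearcey kernel: $$\mathbb K^{\rm P}_{\tau_1,\tau_2}(u,v):=\frac1{(2\pi i)^2}\int_{i\mathbb R}d\zeta\int_{\Gamma^{\rm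 P}}d\omega\,\frac{\exp(-\frac{\zeta^4}4-\frac{\tau_2\zeta^2}2-v\zeta+\frac{\omega^4}4+\frac{\tau_1\omega^2}2+u\omega)}{\zeta-\omega}-1(\tau_1>\tau_2)\frac{\exp(-\frac{(u-v)^2}{2(\tau_1-\tau_2)})}{\sqrt{2\pi(\tau_1-\tau_2)}},$$ where $i\mathbb R$ is oriented upwards and $\Gamma^{\rm P}$ consists of four rays, two from the origin to $\pm\infty e^{-i\pi/4}$ and two from $\pm\infty e^{i\pi/4}$ to the origin. Transition kernel with parameter $a\ge0$: $$\mathbb K^a_{\tau_1,\tau_2}(u,v):=\frac1{(2\pi i)^2}\int_{i\mathbb R}d\zeta\int_{\Gamma^{\rm P}}d\omega\,\frac{\exp(-\frac{\zeta^4}4+\frac{a\zeta^3}3-\frac{\tau_2\zeta^2}2-v\zeta+\frac{\omega^4}4-\frac{a\omega^3}3+\frac{\tau_1\omega^2}2+u\omega)}{\zeta-\omega}-1(\tau_1>\tau_2)\frac{\exp(-\frac{(u-v)^2}{2(\tau_1-\tau_2)})}{\sqrt{2\pi(\tau_1-\tau_2)}}$$ with the same contours as for the Pearcey kernel. (The singularity of the integrands at $\zeta=\omega=0$ is integrable.) *)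

(* Defs.v *)
From mathcomp Require Import all_boot all_order all_algebra.
From mathcomp Require Import all_classical all_reals all_analysis.
From mathcomp Require Import complex.

Set Implicit Arguments.
Unset Strict Implicit.
Unset Printing Implicit Defensive.

Import Order.TTheory GRing.Theory Num.Theory.
Import numFieldNormedType.Exports.

Local Open Scope classical_set_scope.
Local Open Scope ring_scope.
Local Open Scope complex_scope.

Definition cexp {R : realType} (z : R[i]) : R[i] :=
  (expR (complex.Re z))%:C * (cos (complex.Im z) +i* sin (complex.Im z)).

(* Componentwise; for a non-integrable function the value is meaningless, but
   all the integrals taken in the kernels below converge absolutely. *)
Definition cintegral {R : realType} (D : set R) (f : R -> R[i]) : R[i] :=
  (\int[lebesgue_measure]_(x in D) complex.Re (f x))
  +i* (\int[lebesgue_measure]_(x in D) complex.Im (f x)).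

(* The contours below are unions of rays with endpoint 0; a ray is given by its
   unit direction d.  [Outgoing d] runs from 0 to (infinity d) and [Incoming d]
   runs from (infinity d) to 0. *)
Variant oriented_ray (R : realType) : Type :=
  | Outgoing of R[i]
  | Incoming of R[i].

(* Parametrization z = r d, dz = d dr, with 0 < r. *)
Definition ray_integral {R : realType} (d : R[i]) (f : R[i] -> R[i]) : R[i] :=
  cintegral `]0, +oo[ (fun r => f (r%:C * d) * d).

Definition contour_integral {R : realType} (g : seq (oriented_ray R))
    (f : R[i] -> R[i]) : R[i] :=
  \sum_(e <- g) match e with
                | Outgoing d => ray_integral d f
                | Incoming d => - ray_integral d f
                end.

Definition cis {R : realType} (t : R) : R[i] := cexp ('i%C * t%:C).

Definition airy_Sigma (R : realType) : seq (oriented_ray R) :=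
  [:: Incoming (cis (- (pi / 3))); Outgoing (cis (pi / 3))].

Definition airy_Gamma (R : realType) : seq (oriented_ray R) :=
  [:: Incoming (cis (- (2 * pi / 3))); Outgoing (cis (2 * pi / 3))].

Definition imaginary_axis (R : realType) : seq (oriented_ray R) :=
  [:: Incoming (- 'i%C); Outgoing 'i%C].

Definition pearcey_Gamma (R : realType) : seq (oriented_ray R) :=
  [:: Outgoing (cis (- (pi / 4))); Outgoing (- cis (- (pi / 4)));
      Incoming (cis (pi / 4)); Incoming (- cis (pi / 4))].

Definition airy_kernel {R : realType} (tau1 tau2 u v : R) : R[i] :=
  ((2 * pi%:C * 'i%C) ^+ 2)^-1 *
  contour_integral (airy_Sigma R) (fun z =>
    contour_integral (airy_Gamma R) (fun w =>
      cexp (z ^+ 3 / 3 - z * v%:C - tau2%:C * z ^+ 2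
            - w ^+ 3 / 3 + w * u%:C + tau1%:C * w ^+ 2) / (z - w)))
  - (if tau1 > tau2 then
       expR (- ((u - v) ^+ 2 / (4 * (tau1 - tau2))))
         / Num.sqrt (4 * pi * (tau1 - tau2))
     else 0)%:C.

Definition pearcey_kernel {R : realType} (tau1 tau2 u v : R) : R[i] :=
  ((2 * pi%:C * 'i%C) ^+ 2)^-1 *
  contour_integral (imaginary_axis R) (fun z =>
    contour_integral (pearcey_Gamma R) (fun w =>
      cexp (- (z ^+ 4 / 4) - tau2%:C * z ^+ 2 / 2 - v%:C * z
            + w ^+ 4 / 4 + tau1%:C * w ^+ 2 / 2 + u%:C * w) / (z - w)))
  - (if tau1 > tau2 then
       expR (- ((u - v) ^+ 2 / (2 * (tau1 - tau2))))
         / Num.sqrt (2 * pi * (tau1 - tau2))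
     else 0)%:C.

Definition transition_kernel {R : realType} (a tau1 tau2 u v : R) : R[i] :=
  ((2 * pi%:C * 'i%C) ^+ 2)^-1 *
  contour_integral (imaginary_axis R) (fun z =>
    contour_integral (pearcey_Gamma R) (fun w =>
      cexp (- (z ^+ 4 / 4) + a%:C * z ^+ 3 / 3
            - tau2%:C * z ^+ 2 / 2 - v%:C * z
            + w ^+ 4 / 4 - a%:C * w ^+ 3 / 3
            + tau1%:C * w ^+ 2 / 2 + u%:C * w) / (z - w)))
  - (if tau1 > tau2 then
       expR (- ((u - v) ^+ 2 / (2 * (tau1 - tau2))))
         / Num.sqrt (2 * pi * (tau1 - tau2))
     else 0)%:C.

(* Main.v *)
(* With [a > 0], [z = a^(-1/3) zeta], [w = a^(-1/3) omega] and [eps = a^(-4/3)],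
   the exponents become those of the Airy kernel plus [- eps zeta^4 / 4] and
   [+ eps omega^4 / 4], and the Gaussian terms agree exactly.  The rays of [zeta]
   are rotated from [+-i] to [1 +- 3i], a direction along which both
   [- zeta^4] and [zeta^3] decay; the Airy rays [exp(+-i pi/3)] rotate to the
   same place, and the left rays of [omega] and [exp(+-2i pi/3)] to [-1 +- i].  There
   the integrands are dominated uniformly in [eps] and dominated convergence
   applies.  The two right rays of [omega] are translated together by [1/eps], the
   saddle point of [eps omega^4/4 - omega^3/3], where they contribute
   [O(exp(- c/eps^3))].

   A ray is deformed by differentiating its integral in the deformation parameter:
   the derivative of the integrand is an exact derivative along the ray, so only a
   boundary term at the origin of the ray remains.  It vanishes for a rotation, and
   cancels between the two translated rays. *)
Require Import Defs.
From mathcomp Require Import all_boot all_order all_algebra.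
From mathcomp Require Import all_classical all_reals all_analysis.
From mathcomp Require Import measurable_realfun complex ring lra.

Set Implicit Arguments.
Unset Strict Implicit.
Unset Printing Implicit Defensive.

Import Order.TTheory GRing.Theory Num.Theory.
Import numFieldNormedType.Exports.

Local Open Scope classical_set_scope.
Local Open Scope ring_scope.
Local Open Scope complex_scope.

(** * Complex numbers and measurability *)

(** All rays start at 0, where [1 / (z - w)] is singular, whereas differentiation under the integral
    sign needs a bounded integrand. Every deformation is therefore made on a single integral, with
    the other variable frozen at a nonzero point that stays at positive distance from the moving
    ray. Deforming the outer variable requires an exchange of the integrals first.

    Directions may have any length, and the straight segment between two directions changes angle
    and length together. The substitution [z = a^(-1/3) zeta] then needs no change of variables
    under the integral: a ray is moved to a multiple of the new direction, and the multiple is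
    absorbed algebraically.

    The right rays of [omega] cannot join the dominated convergence argument: [Re (w ^+ 3)] is
    negative on [1 +- i], so [- w ^+ 3 / 3] grows there, only the vanishing quartic term gives
    decay, and the limiting integrand is not integrable. *)

Notation cre := (@complex.Re _).
Notation cim := (@complex.Im _).
Notation cnorm := (@ComplexField.Normc.normc _).

Section ComplexAlgebra.
Context {R : realType}.
Implicit Types (x y : R) (z w : R[i]).

Lemma creD z w : cre (z + w) = cre z + cre w. Proof. by case: z; case: w. Qed.
Lemma cimD z w : cim (z + w) = cim z + cim w. Proof. by case: z; case: w. Qed.
Lemma creN z : cre (- z) = - cre z. Proof. by case: z. Qed.
Lemma cimN z : cim (- z) = - cim z. Proof. by case: z. Qed.
Lemma creM z w : cre (z * w) = cre z * cre w - cim z * cim w.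
Proof. by case: z; case: w. Qed.
Lemma cimM z w : cim (z * w) = cre z * cim w + cim z * cre w.
Proof. by case: z; case: w. Qed.
Lemma creV z : cre z^-1 = cre z / (cre z ^+ 2 + cim z ^+ 2).
Proof. by case: z. Qed.
Lemma cimV z : cim z^-1 = - (cim z / (cre z ^+ 2 + cim z ^+ 2)).
Proof. by case: z. Qed.
Lemma creexp z : cre (cexp z) = expR (cre z) * cos (cim z).
Proof. by rewrite /cexp creM /= mul0r subr0. Qed.
Lemma cimexp z : cim (cexp z) = expR (cre z) * sin (cim z).
Proof. by rewrite /cexp cimM /= mul0r addr0. Qed.

Lemma complexP z w : cre z = cre w -> cim z = cim w -> z = w.
Proof. by case: z => ? ?; case: w => ? ? /= -> ->. Qed.

Lemma cnormE z : cnorm z = Num.sqrt (cre z ^+ 2 + cim z ^+ 2).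
Proof. by case: z. Qed.
Lemma cnorm_ge0 z : 0 <= cnorm z. Proof. by rewrite cnormE sqrtr_ge0. Qed.
Lemma cnorm_sqr z : cnorm z ^+ 2 = cre z ^+ 2 + cim z ^+ 2.
Proof. by rewrite cnormE sqr_sqrtr// addr_ge0 ?sqr_ge0. Qed.
Lemma cnormM z w : cnorm (z * w) = cnorm z * cnorm w.
Proof. exact: ComplexField.Normc.normcM. Qed.
Lemma cnormV z : cnorm z^-1 = (cnorm z)^-1.
Proof. exact: ComplexField.Normc.normcV. Qed.
Lemma cnormD z w : cnorm (z + w) <= cnorm z + cnorm w.
Proof.
have := ler_normD z w; rewrite -[`|z + w|]/((cnorm (z + w))%:C).
by rewrite -[`|z|]/((cnorm z)%:C) -[`|w|]/((cnorm w)%:C) -rmorphD lecR.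
Qed.
Lemma cnormN z : cnorm (- z) = cnorm z.
Proof. by rewrite !cnormE creN cimN !sqrrN. Qed.
Lemma cnorm_real x : cnorm x%:C = `|x|.
Proof. by rewrite cnormE /= expr0n/= addr0 sqrtr_sqr. Qed.
Lemma cnormX z n : cnorm (z ^+ n) = cnorm z ^+ n.
Proof.
elim: n => [|n IH]; last by rewrite !exprS cnormM IH.
by rewrite !expr0 -[1]/((1:R)%:C) cnorm_real normr1.
Qed.
Lemma cnormMn z n : cnorm (z *+ n) = cnorm z *+ n.
Proof.
rewrite -mulr_natl cnormM -(rmorph_nat (real_complex R)) cnorm_real normr_nat.
by rewrite mulr_natl.
Qed.
Lemma cnorm_eq0 z : (cnorm z == 0) = (z == 0).
Proof.
apply/eqP/eqP => [|->]; first exact: ComplexField.Normc.eq0_normc.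
by rewrite -[0]/((0:R)%:C) cnorm_real normr0.
Qed.
Lemma cre_le_cnorm z : `|cre z| <= cnorm z.
Proof. by rewrite cnormE -sqrtr_sqr ler_wsqrtr// lerDl sqr_ge0. Qed.
Lemma cim_le_cnorm z : `|cim z| <= cnorm z.
Proof. by rewrite cnormE -sqrtr_sqr ler_wsqrtr// lerDr sqr_ge0. Qed.
Lemma cnorm_le_re_im z : cnorm z <= `|cre z| + `|cim z|.
Proof.
rewrite -(@ler_pXn2r _ 2) ?nnegrE ?cnorm_ge0 ?addr_ge0//.
rewrite cnorm_sqr sqrrD !real_normK ?num_real// lerD2r lerDl.
by rewrite mulrn_wge0// mulr_ge0.
Qed.
Lemma cnorm_exp z : cnorm (cexp z) = expR (cre z).
Proof.
rewrite cnormE creexp cimexp !exprMn -mulrDr cos2Dsin2 mulr1.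
by rewrite sqrtr_sqr ger0_norm// expR_ge0.
Qed.
Lemma cexpD z w : cexp (z + w) = cexp z * cexp w.
Proof.
apply: complexP.
  by rewrite creexp [RHS]creM !creexp !cimexp creD cimD expRD cosD; ring.
by rewrite cimexp [RHS]cimM !creexp !cimexp creD cimD expRD sinD; ring.
Qed.

Lemma rmulC x z : x%:C * z = (x * cre z) +i* (x * cim z).
Proof. by apply: complexP; rewrite ?creM ?cimM/= mul0r ?subr0 ?addr0. Qed.

End ComplexAlgebra.

Section ComplexMeasurable.
Context {R : realType} {d : measure_display} {T : measurableType d}.
Implicit Types (f g : T -> R[i]).

Definition cmeasurable f :=
  measurable_fun setT (cre \o f) /\ measurable_fun setT (cim \o f).

(** Inversion, with [0^-1 = 0], is continuous away from 0, and the single point 0 is handled on its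
    own. *)
Lemma measurable_invr : measurable_fun [set: R] (@GRing.inv R).
Proof.
have -> : [set: R] = [set 0] `|` ~` [set 0] by rewrite setUv.
apply/measurable_funU => //; first exact: measurableC.
split; first exact: measurable_fun_set1.
apply: open_continuous_measurable_fun.
  by apply: closed_openC; exact: closed_eq.
by move=> x; rewrite inE/= => /eqP x0; exact: inv_continuous.
Qed.

Lemma cmeas_cst z : cmeasurable (cst z).
Proof. by split; exact: measurable_cst. Qed.

Lemma cmeas_real (f : T -> R) : measurable_fun setT f ->
  cmeasurable (fun x => (f x)%:C).
Proof. by move=> mf; split => //; exact: measurable_cst. Qed.

Lemma cmeasD f g : cmeasurable f -> cmeasurable g ->
  cmeasurable (fun x => f x + g x).
Proof.
move=> [f1 f2] [g1 g2]; split; rewrite /comp.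
  by under eq_fun do rewrite creD; apply: measurable_funD.
by under eq_fun do rewrite cimD; apply: measurable_funD.
Qed.

Lemma cmeasN f : cmeasurable f -> cmeasurable (fun x => - f x).
Proof.
move=> [f1 f2]; split; rewrite /comp.
  by under eq_fun do rewrite creN; apply: measurable_funN.
by under eq_fun do rewrite cimN; apply: measurable_funN.
Qed.

Lemma cmeasB f g : cmeasurable f -> cmeasurable g ->
  cmeasurable (fun x => f x - g x).
Proof. by move=> mf mg; apply: cmeasD => //; exact: cmeasN. Qed.

Lemma cmeasM f g : cmeasurable f -> cmeasurable g ->
  cmeasurable (fun x => f x * g x).
Proof.
move=> [f1 f2] [g1 g2]; split; rewrite /comp.
  under eq_fun do rewrite creM.
  by apply: measurable_funB; apply: measurable_funM.
under eq_fun do rewrite cimM.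
by apply: measurable_funD; apply: measurable_funM.
Qed.

Lemma cmeasX f n : cmeasurable f -> cmeasurable (fun x => f x ^+ n).
Proof.
move=> mf; elim: n => [|n IH]; first exact: cmeas_cst.
by under eq_fun do rewrite exprS; apply: cmeasM.
Qed.

Lemma cmeasV f : cmeasurable f -> cmeasurable (fun x => (f x)^-1).
Proof.
move=> [f1 f2].
have mi : measurable_fun setT (fun x => (cre (f x) ^+ 2 + cim (f x) ^+ 2)^-1).
  apply: measurableT_comp; first exact: measurable_invr.
  by apply: measurable_funD; apply: measurable_funX.
split; rewrite /comp.
  by under eq_fun do rewrite creV; apply: measurable_funM.
by under eq_fun do rewrite cimV; apply: measurable_funN; apply: measurable_funM.
Qed.

Lemma cmeas_exp f : cmeasurable f -> cmeasurable (fun x => cexp (f x)).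
Proof.
move=> [f1 f2].
have me : measurable_fun setT (fun x => expR (cre (f x))).
  exact: measurableT_comp.
split; rewrite /comp.
  under eq_fun do rewrite creexp; apply: measurable_funM => //.
  apply: (measurableT_comp _ f2).
  by apply: continuous_measurable_fun; exact: continuous_cos.
under eq_fun do rewrite cimexp; apply: measurable_funM => //.
apply: (measurableT_comp _ f2).
by apply: continuous_measurable_fun; exact: continuous_sin.
Qed.

End ComplexMeasurable.

(** * Derivatives along curves *)

Section ComplexDerivative.
Context {R : realType}.
Implicit Types (f g : R -> R[i]) (x : R) (l m z : R[i]).

Definition cderiv f x l :=
  is_derive x 1 (fun y => cre (f y)) (cre l) /\
  is_derive x 1 (fun y => cim (f y)) (cim l).

(* Holomorphy at a point, in the form of a chain rule along curves. *)
Definition cholo (F : R[i] -> R[i]) z l :=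
  forall f x m, f x = z -> cderiv f x m -> cderiv (F \o f) x (l * m).

Let isdD (f g : R -> R) x (a b : R) : is_derive x 1 f a -> is_derive x 1 g b ->
  is_derive x 1 (fun y => f y + g y) (a + b).
Proof. exact: is_deriveD. Qed.

Let isdN (f : R -> R) x (a : R) : is_derive x 1 f a ->
  is_derive x 1 (fun y => - f y) (- a).
Proof. exact: is_deriveN. Qed.

Let isdM (f g : R -> R) x (a b : R) : is_derive x 1 f a -> is_derive x 1 g b ->
  is_derive x 1 (fun y => f y * g y) (a * g x + f x * b).
Proof.
move=> df dg; rewrite addrC (mulrC a).
exact: (is_deriveM df dg).
Qed.

Let isdV (f : R -> R) x (a : R) : f x != 0 -> is_derive x 1 f a ->
  is_derive x 1 (fun y => (f y)^-1) (- a / f x ^+ 2).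
Proof.
by move=> fx0 df; rewrite mulNr mulrC -mulNr; exact: (is_deriveV fx0 df).
Qed.

Let isd_eq (f g : R -> R) x (a b : R) : is_derive x 1 f a -> f =1 g -> a = b ->
  is_derive x 1 g b.
Proof. by move=> df /funext <- <-. Qed.

Lemma cderiv_cst z x : cderiv (cst z) x 0.
Proof. by split; exact: is_derive_cst. Qed.

Lemma cderiv_real (h : R -> R) x (a : R) :
  is_derive x 1 h a -> cderiv (fun y => (h y)%:C) x a%:C.
Proof. by move=> dh; split => //=; exact: is_derive_cst. Qed.

Lemma cderiv_eq f x l m : l = m -> cderiv f x l -> cderiv f x m.
Proof. by move=> ->. Qed.

Lemma cderivD f g x l m : cderiv f x l -> cderiv g x m ->
  cderiv (fun y => f y + g y) x (l + m).
Proof.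
move=> [f1 f2] [g1 g2]; split.
  by under eq_fun do rewrite creD; rewrite creD; exact: isdD.
by under eq_fun do rewrite cimD; rewrite cimD; exact: isdD.
Qed.

Lemma cderivN f x l : cderiv f x l -> cderiv (fun y => - f y) x (- l).
Proof.
move=> [f1 f2]; split.
  by under eq_fun do rewrite creN; rewrite creN; exact: isdN.
by under eq_fun do rewrite cimN; rewrite cimN; exact: isdN.
Qed.

Lemma cderivM f g x l m : cderiv f x l -> cderiv g x m ->
  cderiv (fun y => f y * g y) x (l * g x + f x * m).
Proof.
move=> [f1 f2] [g1 g2]; split.
  apply: (isd_eq (isdD (isdM f1 g1) (isdN (isdM f2 g2)))) => [y|].
    by rewrite creM.
  by rewrite creD !creM; ring.
apply: (isd_eq (isdD (isdM f1 g2) (isdM f2 g1))) => [y|].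
  by rewrite cimM.
by rewrite cimD !cimM; ring.
Qed.

Lemma cderivV f x l : f x != 0 -> cderiv f x l ->
  cderiv (fun y => (f y)^-1) x (- l / f x ^+ 2).
Proof.
move=> fx0 [f1 f2].
have n0 : cre (f x) * cre (f x) + cim (f x) * cim (f x) != 0.
  by rewrite -!expr2 -cnorm_sqr expf_neq0// cnorm_eq0.
(* The squared modulus of [f x * f x]: the denominator that the inverse of [f x ^+ 2] in the claimed
   derivative produces. *)
have n1 : (cre (f x) * cre (f x) - cim (f x) * cim (f x)) ^+ 2 +
    (cre (f x) * cim (f x) + cim (f x) * cre (f x)) ^+ 2 != 0.
  rewrite (_ : _ + _ = (cre (f x) * cre (f x) + cim (f x) * cim (f x)) ^+ 2).
    by rewrite expf_neq0.
  by ring.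
have dn := isdD (isdM f1 f1) (isdM f2 f2).
have dni := @isdV _ x _ n0 dn.
split.
  apply: (isd_eq (isdM f1 dni)) => [y|].
    by rewrite creV !expr2.
  rewrite !expr2 [RHS]creM creV cimV creN cimN creM cimM.
  by move: n0 n1; move: (cre (f x)) (cim (f x)) (cre l) (cim l) => a b p q n0 n1;
  field; rewrite n0 n1.
apply: (isd_eq (isdN (isdM f2 dni))) => [y|].
  by rewrite cimV !expr2.
rewrite !expr2 [RHS]cimM creV cimV creN cimN creM cimM.
by move: n0 n1; move: (cre (f x)) (cim (f x)) (cre l) (cim l) => a b p q n0 n1;
  field; rewrite n0 n1.
Qed.

Lemma cderiv_exp f x l : cderiv f x l ->
  cderiv (fun y => cexp (f y)) x (l * cexp (f x)).
Proof.
move=> [f1 f2].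
have d1 := is_derive1_comp (is_derive_expR (cre (f x))) f1.
have d2 := is_derive1_comp (is_derive_cos (cim (f x))) f2.
have d3 := is_derive1_comp (is_derive_sin (cim (f x))) f2.
split.
  apply: (isd_eq (isdM d1 d2)) => [y|]; first by rewrite creexp.
  by rewrite creM creexp cimexp /GRing.scale/=; ring.
apply: (isd_eq (isdM d1 d3)) => [y|]; first by rewrite cimexp.
by rewrite cimM creexp cimexp /GRing.scale/=; ring.
Qed.

Lemma is_derive_continuous (f : R -> R) x (a : R) : is_derive x 1 f a ->
  {for x, continuous f}.
Proof.
by move=> /@ex_derive df; exact/differentiable_continuous/derivable1_diffP.
Qed.

Lemma cderiv_continuous f x l : cderiv f x l ->
  {for x, continuous (fun y => cre (f y))} /\
  {for x, continuous (fun y => cim (f y))}.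
Proof.
by move=> [f1 f2]; split; [exact: is_derive_continuous f1|
  exact: is_derive_continuous f2].
Qed.

Lemma cholo_id z : cholo id z 1.
Proof. by move=> f x m _ df; rewrite mul1r. Qed.

Lemma cholo_cst c z : cholo (cst c) z 0.
Proof. by move=> f x m _ df; rewrite mul0r; exact: cderiv_cst. Qed.

Lemma choloD F G z l m : cholo F z l -> cholo G z m ->
  cholo (fun w => F w + G w) z (l + m).
Proof.
move=> hF hG f x k fx df; rewrite mulrDl.
exact: (cderivD (hF _ _ _ fx df) (hG _ _ _ fx df)).
Qed.

Lemma choloN F z l : cholo F z l -> cholo (fun w => - F w) z (- l).
Proof. by move=> hF f x k fx df; rewrite mulNr; exact: (cderivN (hF _ _ _ fx df)). Qed.

Lemma choloM F G z l m : cholo F z l -> cholo G z m ->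
  cholo (fun w => F w * G w) z (l * G z + F z * m).
Proof.
move=> hF hG f x k fx df; apply: cderiv_eq; last first.
  exact: (cderivM (hF _ _ _ fx df) (hG _ _ _ fx df)).
by rewrite /= fx; ring.
Qed.

Lemma choloV F z l : F z != 0 -> cholo F z l ->
  cholo (fun w => (F w)^-1) z (- l / F z ^+ 2).
Proof.
move=> F0 hF f x k fx df; apply: cderiv_eq; last first.
  by apply: (cderivV _ (hF _ _ _ fx df)); rewrite /= fx.
by rewrite /= fx; ring.
Qed.

Lemma cholo_exp F z l : cholo F z l ->
  cholo (fun w => cexp (F w)) z (l * cexp (F z)).
Proof.
move=> hF f x k fx df.
apply: cderiv_eq; last exact: (cderiv_exp (hF _ _ _ fx df)).
by rewrite /= fx; ring.
Qed.

Lemma cholo_eq F z l m : l = m -> cholo F z l -> cholo F z m.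
Proof. by move=> ->. Qed.

Lemma choloX n z : cholo (fun w => w ^+ n) z (z ^+ n.-1 *+ n).
Proof.
elim: n => [|n IH]; first exact: cholo_cst.
rewrite (_ : (fun w => w ^+ n.+1) = (fun w => w * w ^+ n)); last first.
  by apply/funext => w; rewrite exprS.
have := choloM (@cholo_id z) IH; rewrite /=; apply: cholo_eq.
case: n {IH} => [|n]; first by rewrite /= mulr0n mulr0 addr0 mul1r expr0 mulr1n.
by rewrite /= mul1r mulrnAr -exprS -mulrS.
Qed.

End ComplexDerivative.

(** * Integrals over the half-line *)

Section HalfLine.
Context {R : realType}.
Local Notation mu := (@lebesgue_measure R).
Local Notation pos := (`]0, +oo[%classic : set (measurableTypeR R)).
Implicit Types (r : R) (f g : R -> R) (F G : R -> R[i]).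

Definition rintegrable f := mu.-integrable pos (EFin \o f).

Lemma measurable_pos : measurable pos.
Proof. exact: measurable_itv. Qed.
Hint Resolve measurable_pos : core.

Lemma rintegrable_dom f g : measurable_fun pos f ->
  (forall r, 0 < r -> `|f r| <= g r) -> rintegrable g -> rintegrable f.
Proof.
move=> mf fg; apply: le_integrable => //; first exact/measurable_EFinP.
move=> r; rewrite /= in_itv/= andbT => r0; rewrite lee_fin.
by rewrite (le_trans (fg _ r0))// ler_norm.
Qed.

Lemma rintegrable_expN : rintegrable (fun r => expR (- r)).
Proof.
have := integrableS (@measurableT _ (measurableTypeR R)) measurable_pos (@subsetT _ _)
  (integrable_exponential_pdf (@ltr01 R)).
apply: eq_integrable => // r; rewrite inE/= in_itv/= andbT => r0.
by rewrite exponential_pdfE ?ltW// mul1r mulN1r.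
Qed.

Lemma rintegrableZ f k : rintegrable f -> rintegrable (fun r => k * f r).
Proof. by move=> fi; have := integrableZl measurable_pos k fi. Qed.

(* An integrable majorant: the singularity of the kernels is controlled by
   [1 / (r + s) <= 1 / (sqrt r * sqrt s)]. *)
Definition halfpow (r : R) : R := (Num.sqrt r * (1 + r))^-1.

Lemma halfpow_ge0 r : 0 < r -> 0 <= halfpow r.
Proof. by move=> r0; rewrite invr_ge0 mulr_ge0 ?sqrtr_ge0// ltW// ltr_wpDr// ltW. Qed.

(** An explicit primitive that is nonnegative and tends to [pi] at infinity, so the integrals over
    [[a, +oo[] are bounded independently of [a]. *)
Lemma is_derive_halfpow r : 0 < r ->
  is_derive r 1 (fun x => 2 * atan (Num.sqrt x)) (halfpow r).
Proof.
move=> r0.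
have s0 : Num.sqrt r != 0 by rewrite gt_eqF// sqrtr_gt0.
have r1 : 1 + r != 0 by rewrite gt_eqF// addr_gt0.
have := is_deriveM (is_derive_cst (2 : R) r (1 : R))
  (is_derive1_comp (is_derive1_atan (Num.sqrt r)) (is_derive1_sqrt r0)).
rewrite (_ : _ + _ = halfpow r)//.
rewrite /GRing.scale/= mulr0 addr0 sqr_sqrtr ?ltW// /halfpow.
by field; rewrite s0 r1.
Qed.

Lemma halfpow_continuous r : 0 < r -> {for r, continuous halfpow}.
Proof.
move=> r0; rewrite /halfpow; apply: cvgV.
  by rewrite mulf_neq0 ?gt_eqF ?sqrtr_gt0// ltr_wpDr// ltW.
apply: cvgM; first exact: sqrt_continuous.
by apply: cvgD; [exact: cvg_cst|exact: cvg_id].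
Qed.

Lemma measurable_halfpow : measurable_fun pos halfpow.
Proof.
apply: open_continuous_measurable_fun; first exact: interval_open.
by move=> r; rewrite inE/= in_itv/= andbT; exact: halfpow_continuous.
Qed.

Lemma cvgy_sqrt : (@Num.sqrt R) x @[x --> +oo] --> +oo.
Proof.
apply/cvgryPge => A; near=> x.
have A0 : A <= `|A| by rewrite ler_norm.
have Ax : A ^+ 2 <= x by near: x; apply: nbhs_pinfty_ge; rewrite num_real.
by apply: (le_trans A0); rewrite -sqrtr_sqr ler_wsqrtr.
Unshelve. all: by end_near. Qed.

Lemma integral_halfpow (a : R) : 0 < a ->
  (\int[mu]_(r in `[a, +oo[) (halfpow r)%:E <= pi%:E)%E.
Proof.
move=> a0.
rewrite (@ge0_continuous_FTC2y _ halfpow (fun x => 2 * atan (Num.sqrt x)) a pi)//.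
- rewrite -EFinB lee_fin gerBl mulr_ge0// -(@atan0 R) le_atan// sqrtr_ge0.
- by move=> x ax; apply: halfpow_ge0; exact: lt_le_trans ax.
- apply: continuous_in_subspaceT => x; rewrite inE/= in_itv/= andbT => ax.
  by apply: halfpow_continuous; exact: lt_le_trans ax.
- rewrite (_ : pi = 2 * (pi / 2)); last by rewrite mulrC divfK.
  apply: cvgM; first exact: cvg_cst.
  by apply: (@cvg_comp _ _ _ (@Num.sqrt R) (@atan R) _ _ _ cvgy_sqrt); exact: cvgy_atan.
- move=> x ax; apply: ex_derive.
  by apply: is_derive_halfpow; exact: lt_trans ax.
- apply: cvg_at_right_filter.
  exact: (is_derive_continuous (is_derive_halfpow a0)).
- move=> x; rewrite in_itv/= andbT => ax; rewrite derive1E.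
  apply: derive_val; apply: is_derive_halfpow; exact: lt_trans ax.
Qed.

(** The primitive is not differentiable at 0, so the half-line is exhausted by the intervals from
    [1 / (n + 1)], on which the bound [pi] is uniform, and monotone convergence concludes. *)
Lemma rintegrable_halfpow : rintegrable halfpow.
Proof.
apply/integrableP; split; first by apply/measurable_EFinP; exact: measurable_halfpow.
have -> : pos = \bigcup_n `[(n.+1%:R^-1 : R), +oo[%classic.
  apply/seteqP; split => r /=; last first.
    move=> [n _]; rewrite /= !in_itv/= !andbT; apply: lt_le_trans.
    by rewrite invr_gt0.
  rewrite in_itv/= andbT => r0; exists (Num.truncn r^-1) => //=.
  rewrite in_itv/= andbT -[leRHS]invrK lef_pV2 ?posrE ?invr_gt0//.
  by rewrite ltW// truncnS_gt.
apply: (@le_lt_trans _ _ pi%:E); last exact: ltry.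
have h := @ge0_nondecreasing_set_cvg_integral _ (measurableTypeR R) R
  (fun n => `[(n.+1%:R^-1 : R), +oo[%classic) (fun r => `|(halfpow r)%:E|%E)
  (@lebesgue_measure R).
apply: (cvge_to_le (h _ _ _ _)) => //.
- move=> m n mn; rewrite subsetEset => r /=; rewrite !in_itv/= !andbT.
  by apply: le_trans; rewrite lef_pV2 ?posrE// ler_nat.
- move=> n; apply/measurable_EFinP; apply: measurableT_comp => //.
  apply: (measurable_funS measurable_pos) measurable_halfpow.
  move=> r /=; rewrite !in_itv/= !andbT; apply: lt_le_trans.
  by rewrite invr_gt0.
apply: nearW => n /=.
have n0 : 0 < (n.+1%:R^-1 : R) by rewrite invr_gt0.
apply: le_trans (integral_halfpow n0).
rewrite le_eqVlt; apply/orP; left; apply/eqP/eq_integral => r.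
rewrite inE/= in_itv/= andbT => nr.
by rewrite ger0_norm// halfpow_ge0//; exact: lt_le_trans nr.
Qed.

(** The fundamental theorem on a half-line is applied to nonnegative integrands only. The sum of [k]
    and its majorant [K * expR (- r)] is nonnegative, and the integral of the majorant is subtracted
    afterwards. *)
Lemma Rintegral_ray_derive (h k : R -> R) (K : R) :
  (forall r, 0 <= r -> is_derive r 1 h (k r)) ->
  (forall r, 0 <= r -> {for r, continuous k}) ->
  (forall r, 0 <= r -> `|k r| <= K * expR (- r)) ->
  h r @[r --> +oo] --> 0 ->
  \int[mu]_(r in pos) k r = - h 0.
Proof.
move=> hk ck kK h0.
have K0 : 0 <= K.
  have := kK 0 (lexx _); rewrite oppr0 expR0 mulr1; exact: le_trans.
have mk : measurable_fun pos k.
  apply: open_continuous_measurable_fun; first exact: interval_open.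
  by move=> r; rewrite inE/= in_itv/= andbT => /ltW; exact: ck.
have iE : rintegrable (fun r => K * expR (- r)).
  exact/rintegrableZ/rintegrable_expN.
have ik : rintegrable k by apply: rintegrable_dom iE => // r /ltW; exact: kK.
have dE c r : is_derive r 1 (fun x : R => c * expR (- x)) (- (c * expR (- r))).
  have := is_deriveM (is_derive_cst c r (1 : R))
    (is_derive1_comp (is_derive_expR (- r)) (is_deriveN (is_derive_id r (1:R)))).
  rewrite (_ : _ + _ = - (c * expR (- r)))//.
  by rewrite /GRing.scale/= mulr0 addr0; ring.
have cE c r : {for r, continuous (fun x : R => c * expR (- x))}.
  exact: (is_derive_continuous (dE c r)).
have key g H c : (forall r, 0 <= r -> 0 <= g r) ->
   (forall r, 0 <= r -> is_derive r 1 H (g r)) ->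
   (forall r, 0 <= r -> {for r, continuous g}) ->
   H r @[r --> +oo] --> c -> \int[mu]_(r in pos) g r = c - H 0.
  move=> g0 Hg cg Hc; rewrite /Rintegral integral_itv_obnd_cbnd; last first.
    apply/measurable_EFinP.
    apply: open_continuous_measurable_fun; first exact: interval_open.
    by move=> r; rewrite inE/= in_itv/= andbT => /ltW; exact: cg.
  rewrite (@ge0_continuous_FTC2y _ g H 0 c)//.
  - apply: continuous_in_subspaceT => x; rewrite inE/= in_itv/= andbT => ax.
    exact: cg.
  - by move=> x /ltW ax; apply: ex_derive; exact: Hg.
  - apply: cvg_at_right_filter.
    exact: (is_derive_continuous (Hg 0 (lexx 0))).
  - move=> x; rewrite in_itv/= andbT => /ltW ax; rewrite derive1E.
    by apply: derive_val; exact: Hg.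
have E0 c : (fun r : R => c * expR (- r)) r @[r --> +oo] --> 0.
  by rewrite -[X in _ --> X](mulr0 c); apply: cvgM; [exact: cvg_cst|exact: cvgr_expR].
have H1 : \int[mu]_(r in pos) (K * expR (- r)) = K.
  apply: (@eq_trans _ _ (0 - (- K * expR (- 0)))).
    apply: (key _ (fun r : R => - K * expR (- r)) 0).
    - by move=> r _; rewrite mulr_ge0// expR_ge0.
    - by move=> r _; have := dE (- K) r; rewrite mulNr opprK.
    - by move=> r _; exact: cE.
    - exact: E0.
  by rewrite oppr0 expR0 mulr1 opprK add0r.
have H2 : \int[mu]_(r in pos) (k r + K * expR (- r)) = - h 0 + K.
  apply: (@eq_trans _ _ (0 - (h 0 + - K * expR (- 0)))).
    apply: (key _ (fun r : R => h r + - K * expR (- r)) 0).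
    - move=> r r0; have := kK r r0; rewrite ler_norml => /andP[+ _].
      by rewrite -subr_ge0 opprK.
    - move=> r r0; apply: is_deriveD; first exact: hk.
      by have := dE (- K) r; rewrite mulNr opprK.
    - by move=> r r0; apply: cvgD; [exact: ck|exact: cE].
    - by rewrite -[X in _ --> X](addr0 0); apply: cvgD; [exact: h0|exact: E0].
  by rewrite oppr0 expR0 mulr1 add0r opprD opprK.
by move: H2; rewrite RintegralD// H1 => /addIr.
Qed.

End HalfLine.

(** * Differentiation of ray integrals in a parameter *)

Section RayDerivative.
Context {R : realType}.
Local Notation mu := (@lebesgue_measure R).
Local Notation pos := (`]0, +oo[%classic : set (measurableTypeR R)).
Implicit Types (r s t K : R).
Hint Resolve measurable_pos : core.

Lemma measurable_continuous_pos (f : R -> R) :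
  (forall r, 0 < r -> {for r, continuous f}) -> measurable_fun pos f.
Proof.
move=> cf; apply: open_continuous_measurable_fun; first exact: interval_open.
by move=> r; rewrite inE/= in_itv/= andbT; exact: cf.
Qed.

Lemma cvgy_le_expN (f : R -> R) K : (forall r, 0 <= r -> `|f r| <= K * expR (- r)) ->
  f r @[r --> +oo] --> 0.
Proof.
move=> fK; apply: norm_cvg0.
apply: (@squeeze_cvgr _ _ _ _ (cst 0) (fun r => K * expR (- r))).
- near=> r.
  have r0 : 0 <= r by near: r; apply: nbhs_pinfty_ge; rewrite num_real.
  by rewrite /= normr_ge0/= fK.
- exact: cvg_cst.
- rewrite -[X in _ --> X](mulr0 K).
  by apply: cvgM; [exact: cvg_cst|exact: cvgr_expR].
Unshelve. all: by end_near. Qed.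

(* The parameter derivative of the integrand is an exact derivative along the
   ray, so that differentiating under the integral only leaves the boundary term
   at the origin of the ray. *)
Lemma is_derive_ray_integral (g h k : R -> R -> R) K t :
  (forall s r, 0 <= r -> is_derive s 1 (g^~ r) (k s r)) ->
  (forall s r, 0 <= r -> is_derive r 1 (h s) (k s r)) ->
  (forall s r, 0 <= r -> {for r, continuous (k s)}) ->
  (forall s r, 0 <= r -> {for r, continuous (g s)}) ->
  (forall s r, 0 <= r -> `|k s r| <= K * expR (- r)) ->
  (forall s r, 0 <= r -> `|g s r| <= K * expR (- r)) ->
  (forall s r, 0 <= r -> `|h s r| <= K * expR (- r)) ->
  is_derive t 1 (fun s => \int[mu]_(r in pos) g s r) (- h t 0).
Proof.
move=> gk hk ck cg kK gK hK.
have K0 : 0 <= K.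
  have := kK 0 0 (lexx _); rewrite oppr0 expR0 mulr1; exact: le_trans.
(* The bounds are uniform in [s], so any neighbourhood of [t] serves. *)
have t_in : `]t - 1, t + 1[%classic t.
  by rewrite /= in_itv/= ltrBlDr ltrDl ltr01.
have ig s : `]t - 1, t + 1[%classic s -> mu.-integrable pos (EFin \o g s).
  move=> _; apply: (rintegrable_dom _ _ (rintegrableZ K rintegrable_expN)).
    by apply: measurable_continuous_pos => r /ltW; exact: cg.
  by move=> r /ltW; exact: gK.
have dg s r : `]t - 1, t + 1[%classic s -> pos r -> derivable (g^~ r) s 1.
  move=> _ /=; rewrite in_itv/= andbT => /ltW r0.
  by apply: ex_derive; exact: gk.
have d1E s r : pos r -> partial1of2 g s r = k s r.
  rewrite /= in_itv/= andbT => /ltW r0; rewrite partial1of2E.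
  by apply: derive_val; exact: gk.
have G0 r : 0 <= K * expR (- r) by rewrite mulr_ge0// expR_ge0.
have Gub s r : `]t - 1, t + 1[%classic s -> pos r ->
    `|partial1of2 g s r| <= K * expR (- r).
  move=> _ pr; rewrite d1E//; apply: kK.
  by move: pr; rewrite /= in_itv/= andbT => /ltW.
have iK := rintegrableZ K rintegrable_expN.
pose Phi s := \int[mu]_(r in pos) g s r.
have D1 : derivable Phi t 1.
  exact: (@derivable_under_integral R _ _ (@lebesgue_measure R) g pos
    measurable_pos t (t - 1) (t + 1) t_in ig dg _ G0 iK Gub).
have D2 : derive1 Phi t = \int[mu]_(r in pos) partial1of2 g t r.
  exact: (@differentiation_under_integral R _ _ (@lebesgue_measure R) g pos
    measurable_pos t (t - 1) (t + 1) t_in ig dg _ G0 iK Gub).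
apply: DeriveDef; first exact: D1.
rewrite -derive1E D2.
have -> : \int[mu]_(r in pos) partial1of2 g t r = \int[mu]_(r in pos) k t r.
  by apply: eq_Rintegral => r; rewrite inE => pr; rewrite d1E.
exact: (Rintegral_ray_derive (hk t) (ck t) (kK t) (cvgy_le_expN (hK t))).
Qed.

(** For the point [c s + r d s], the mixed partial derivatives agree. Hence the [s]-derivative of
    [F] times the [r]-velocity is the [r]-derivative of [F] times the [s]-velocity, and at [r = 0]
    the latter product is [F (c s) * c1 s]. The rate 2 in the hypotheses leaves rate 1 once the
    [s]-velocity, which grows linearly in [r], is absorbed into [expR r]. *)
Lemma cderiv_ray_integral (F F1 : R[i] -> R[i]) (c d c1 d1 : R -> R[i]) K t :
  (forall s, cderiv c s (c1 s)) -> (forall s, cderiv d s (d1 s)) ->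
  (forall s r, 0 <= r -> cholo F (c s + r%:C * d s) (F1 (c s + r%:C * d s))) ->
  (forall s r, 0 <= r -> exists l, cholo F1 (c s + r%:C * d s) l) ->
  (forall s r, 0 <= r -> cnorm (F (c s + r%:C * d s)) <= K * expR (- (2 * r))) ->
  (forall s r, 0 <= r -> cnorm (F1 (c s + r%:C * d s)) <= K * expR (- (2 * r))) ->
  (forall s, cnorm (c1 s) <= K) -> (forall s, cnorm (d s) <= K) ->
  (forall s, cnorm (d1 s) <= K) ->
  cderiv (fun s => cintegral `]0, +oo[ (fun r => F (c s + r%:C * d s) * d s)) t
    (- (F (c t) * c1 t)).
Proof.
move=> hc hd hF hF1 bF bF1 bc1 bd bd1.
have K0 : 0 <= K by apply: le_trans (bd 0); exact: cnorm_ge0.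
pose gam s r := c s + r%:C * d s.
pose v s r := c1 s + r%:C * d1 s.
pose g s r := F (gam s r) * d s.
pose h s r := F (gam s r) * v s r.
pose k s r := F1 (gam s r) * v s r * d s + F (gam s r) * d1 s.
have dgam_s s r : cderiv (fun s => gam s r) s (v s r).
  apply: cderiv_eq; last exact: (cderivD (hc s) (cderivM (@cderiv_cst R r%:C s) (hd s))).
  by rewrite mul0r add0r.
have dreal r : cderiv (fun r : R => r%:C) r 1.
  by have := cderiv_real (is_derive_id r (1 : R)).
have daff (a b : R[i]) r : cderiv (fun r => a + r%:C * b) r b.
  apply: cderiv_eq; last first.
    exact: (cderivD (@cderiv_cst R a r) (cderivM (dreal r) (@cderiv_cst R b r))).
  by rewrite add0r mul1r mulr0 addr0.
have dg s r : 0 <= r -> cderiv (fun s => g s r) s (k s r).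
  move=> r0; apply: cderiv_eq; last first.
    exact: (cderivM (hF s r r0 _ _ _ erefl (dgam_s s r)) (hd s)).
  by [].
have dh s r : 0 <= r -> cderiv (h s) r (k s r).
  move=> r0; apply: cderiv_eq; last first.
    exact: (cderivM (hF s r r0 (gam s) r _ erefl (daff _ _ r)) (daff (c1 s) (d1 s) r)).
  by rewrite /k /v /gam /=; ring.
have dgr s r : 0 <= r -> exists l, cderiv (g s) r l.
  move=> r0; eexists.
  exact: (cderivM (hF s r r0 (gam s) r _ erefl (daff _ _ r)) (@cderiv_cst R (d s) r)).
have dk s r : 0 <= r -> exists l, cderiv (k s) r l.
  move=> r0; have [l hl] := hF1 s r r0; eexists.
  have dF := hF s r r0 (gam s) r _ erefl (daff _ _ r).
  have dF1 := hl (gam s) r _ erefl (daff _ _ r).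
  exact: (cderivD (cderivM (cderivM dF1 (daff (c1 s) (d1 s) r))
    (@cderiv_cst R (d s) r)) (cderivM dF (@cderiv_cst R (d1 s) r))).
have bv s r : 0 <= r -> cnorm (v s r) <= K * expR r.
  move=> r0; apply: (le_trans (cnormD _ _)); rewrite cnormM cnorm_real ger0_norm//.
  apply: (@le_trans _ _ (K + r * K)); first by rewrite lerD// ler_wpM2l.
  by rewrite -{1}(mulr1 K) (mulrC r) -mulrDr ler_wpM2l// expR_ge1Dx.
have e2 r : 0 <= r -> expR (- (2 * r)) <= expR (- r).
  by move=> r0; rewrite ler_expR lerN2 ler_peMl// ler1n.
have e1 r : expR (- (2 * r)) * expR r = expR (- r).
  by rewrite -expRD; congr expR; ring.
(* Up to exponentials, [g] and [h] are products of two factors bounded by [K], and [k] adds a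
   product of three to a product of two. *)
pose M := K ^+ 2 + K ^+ 3.
have KM : K ^+ 2 <= M by rewrite lerDl exprn_ge0.
have bg s r : 0 <= r -> cnorm (g s r) <= M * expR (- r).
  move=> r0; rewrite cnormM; apply: (@le_trans _ _ (K * expR (- (2 * r)) * K)).
    by rewrite ler_pM ?cnorm_ge0// bF.
  rewrite mulrAC -expr2; apply: ler_pM; rewrite ?exprn_ge0 ?expR_ge0//.
  exact: e2.
have bh s r : 0 <= r -> cnorm (h s r) <= M * expR (- r).
  move=> r0; rewrite cnormM.
  apply: (@le_trans _ _ (K * expR (- (2 * r)) * (K * expR r))).
    by rewrite ler_pM ?cnorm_ge0// ?bF// bv.
  rewrite mulrACA -expr2 e1; apply: ler_pM; rewrite ?exprn_ge0 ?expR_ge0//.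
have bk s r : 0 <= r -> cnorm (k s r) <= M * expR (- r).
  move=> r0; apply: (le_trans (cnormD _ _)); rewrite !cnormM.
  rewrite /M mulrDl addrC; apply: lerD.
    apply: (@le_trans _ _ (K * expR (- (2 * r)) * K)).
      by rewrite ler_pM ?cnorm_ge0// bF.
    rewrite mulrAC -expr2; apply: ler_pM; rewrite ?exprn_ge0 ?expR_ge0//.
    exact: e2.
  apply: (@le_trans _ _ (K * expR (- (2 * r)) * (K * expR r) * K)).
    by rewrite !ler_pM ?mulr_ge0 ?cnorm_ge0// ?bF1// bv.
  by rewrite -(e1 r) le_eqVlt; apply/orP; left; apply/eqP; ring.
have cre_le (z : R[i]) (x : R) : cnorm z <= x -> `|cre z| <= x.
  by move=> zx; apply: le_trans zx; exact: cre_le_cnorm.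
have cim_le (z : R[i]) (x : R) : cnorm z <= x -> `|cim z| <= x.
  by move=> zx; apply: le_trans zx; exact: cim_le_cnorm.
have h0 : h t 0 = F (c t) * c1 t by rewrite /h /gam /v mul0r addr0 mul0r addr0.
rewrite -h0; split.
- rewrite creN.
  apply: (@is_derive_ray_integral (fun s r => cre (g s r)) (fun s r => cre (h s r))
    (fun s r => cre (k s r)) M).
  + by move=> s r /(dg s)[].
  + by move=> s r /(dh s)[].
  + by move=> s r /(dk s)[l /cderiv_continuous[]].
  + by move=> s r /(dgr s)[l /cderiv_continuous[]].
  + by move=> s r /(bk s) /cre_le.
  + by move=> s r /(bg s) /cre_le.
  + by move=> s r /(bh s) /cre_le.
- rewrite cimN.
  apply: (@is_derive_ray_integral (fun s r => cim (g s r)) (fun s r => cim (h s r))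
    (fun s r => cim (k s r)) M).
  + by move=> s r /(dg s)[].
  + by move=> s r /(dh s)[].
  + by move=> s r /(dk s)[l /cderiv_continuous[]].
  + by move=> s r /(dgr s)[l /cderiv_continuous[]].
  + by move=> s r /(bk s) /cim_le.
  + by move=> s r /(bg s) /cim_le.
  + by move=> s r /(bh s) /cim_le.
Qed.

End RayDerivative.

(** * Deformation of rays *)

Section ContourDeformation.
Context {R : realType}.
Implicit Types (r s t : R) (z q : R[i]).

(* [a] lists the coefficients of [z ^+ 4], [z ^+ 3], [z ^+ 2] and [z]. *)
Definition quartic (a : R * R * R * R) z : R[i] :=
  a.1.1.1%:C * z ^+ 4 + a.1.1.2%:C * z ^+ 3 + a.1.2%:C * z ^+ 2 + a.2%:C * z.

Definition quartic_deriv (a : R * R * R * R) z : R[i] :=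
  a.1.1.1%:C * (z ^+ 3 *+ 4) + a.1.1.2%:C * (z ^+ 2 *+ 3) + a.1.2%:C * (z *+ 2)
  + a.2%:C.

Lemma choloZ (k : R[i]) F z l : cholo F z l -> cholo (fun w => k * F w) z (k * l).
Proof.
move=> hF; have := choloM (@cholo_cst R k z) hF; rewrite /=.
by apply: cholo_eq; rewrite mul0r add0r.
Qed.

Lemma cholo_quartic a z : cholo (quartic a) z (quartic_deriv a z).
Proof.
have h1 := choloZ a.2%:C (@cholo_id R z).
have h2 := choloZ a.1.2%:C (@choloX R 2 z).
have h3 := choloZ a.1.1.2%:C (@choloX R 3 z).
have h4 := choloZ a.1.1.1%:C (@choloX R 4 z).
have := choloD (choloD (choloD h4 h3) h2) h1.
by apply: cholo_eq; rewrite mulr1 expr1.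
Qed.

Lemma cholo_quartic_deriv a z : exists l, cholo (quartic_deriv a) z l.
Proof.
have h1 := @cholo_cst R a.2%:C z.
have hM n F l : cholo F z l -> cholo (fun w : R[i] => F w *+ n) z (n%:R * l).
  move=> /(choloZ n%:R); rewrite (_ : (fun w => F w *+ n) = (fun w => n%:R * F w))//.
  by apply/funext => w; rewrite mulr_natl.
have h2 := choloZ a.1.2%:C (hM 2 _ _ (@cholo_id R z)).
have h3 := choloZ a.1.1.2%:C (hM 3 _ _ (@choloX R 2 z)).
have h4 := choloZ a.1.1.1%:C (hM 4 _ _ (@choloX R 3 z)).
by eexists; exact: (choloD (choloD (choloD h4 h3) h2) h1).
Qed.

Lemma quartic_deriv_bound a : exists2 A, 0 <= A &
  forall z, cnorm (quartic_deriv a z) <= A * (1 + cnorm z) ^+ 3.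
Proof.
pose A := 4 * `|a.1.1.1| + 3 * `|a.1.1.2| + 2 * `|a.1.2| + `|a.2|.
exists A; first by rewrite /A !addr_ge0 ?mulr_ge0.
move=> z; rewrite /quartic_deriv.
apply: (le_trans (cnormD _ _)); apply: (@le_trans _ _
  (4 * `|a.1.1.1| * cnorm z ^+ 3 + 3 * `|a.1.1.2| * cnorm z ^+ 2
   + 2 * `|a.1.2| * cnorm z + `|a.2|)).
  rewrite cnorm_real lerD2r.
  apply: (le_trans (cnormD _ _)); apply: lerD; last first.
    by rewrite cnormM cnorm_real cnormMn; lra.
  apply: (le_trans (cnormD _ _)); apply: lerD; last first.
    by rewrite cnormM cnorm_real cnormMn cnormX; lra.
  by rewrite cnormM cnorm_real cnormMn cnormX; lra.
have n0 := cnorm_ge0 z; move: (cnorm z) n0 => n n0.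
have h3 : n ^+ 3 <= (1 + n) ^+ 3 by rewrite lerXn2r ?nnegrE ?addr_ge0// lerDr.
have h1 : 1 <= (1 + n) ^+ 3 by rewrite exprn_ege1// lerDl.
have h2 : n ^+ 2 <= (1 + n) ^+ 3.
  rewrite (@le_trans _ _ ((1 + n) ^+ 2))// ?lerXn2r ?nnegrE ?addr_ge0// ?lerDr//.
  by rewrite (exprS _ 2) ler_peMl ?exprn_ge0 ?addr_ge0// lerDl.
have h : n <= (1 + n) ^+ 3.
  rewrite (@le_trans _ _ (1 + n))// ?lerDr//.
  by rewrite (exprS _ 2) ler_peMr ?addr_ge0// exprn_ege1// lerDl.
have b3 := ler_wpM2l (normr_ge0 a.1.1.1) h3.
have b2 := ler_wpM2l (normr_ge0 a.1.1.2) h2.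
have b1 := ler_wpM2l (normr_ge0 a.1.2) h.
have b0 := ler_wpM2l (normr_ge0 a.2) h1.
by rewrite /A; lra.
Qed.

(** One variable of the kernel with the other frozen at [q], which becomes the pole. *)
Definition cauchy_exp a q z : R[i] := cexp (quartic a z) / (z - q).

Definition cauchy_exp_deriv a q z : R[i] :=
  (quartic_deriv a z - (z - q)^-1) * cauchy_exp a q z.

Lemma cholo_subC q z : cholo (fun w => w - q) z 1.
Proof.
have := choloD (@cholo_id R z) (@cholo_cst R (- q) z).
by apply: cholo_eq; rewrite addr0.
Qed.

Lemma cholo_cauchy_exp a q z : z != q ->
  cholo (cauchy_exp a q) z (cauchy_exp_deriv a q z).
Proof.
move=> zq; have zq0 : z - q != 0 by rewrite subr_eq0.
have := choloM (cholo_exp (@cholo_quartic a z)) (@choloV R (fun w => w - q) z 1 zq0 (@cholo_subC q z)).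
by apply: cholo_eq; rewrite /cauchy_exp_deriv /cauchy_exp; field.
Qed.

Lemma cholo_cauchy_exp_deriv a q z : z != q ->
  exists l, cholo (cauchy_exp_deriv a q) z l.
Proof.
move=> zq; have zq0 : z - q != 0 by rewrite subr_eq0.
have [l hl] := cholo_quartic_deriv a z.
have h := choloN (@choloV R (fun w => w - q) z 1 zq0 (@cholo_subC q z)).
by eexists; exact: (choloM (choloD hl h) (cholo_cauchy_exp a zq)).
Qed.

Definition segment (z0 z1 : R[i]) t : R[i] := z0 + t%:C * (z1 - z0).

Lemma segment0 z0 z1 : segment z0 z1 0 = z0.
Proof. by rewrite /segment mul0r addr0. Qed.

Lemma segment1 z0 z1 : segment z0 z1 1 = z1.
Proof. by rewrite /segment mul1r addrC subrK. Qed.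

Lemma segment_bound z0 z1 t : 0 <= t <= 1 ->
  cnorm (segment z0 z1 t) <= cnorm z0 + cnorm z1.
Proof.
move=> /andP[t0 t1].
rewrite (_ : segment z0 z1 t = (1 - t)%:C * z0 + t%:C * z1); last first.
  by rewrite /segment rmorphB rmorph1; ring.
apply: (le_trans (cnormD _ _)); rewrite !cnormM !cnorm_real.
rewrite !ger0_norm ?subr_ge0//; apply: lerD.
  by rewrite ler_piMl ?cnorm_ge0// gerBl.
by rewrite ler_piMl ?cnorm_ge0.
Qed.

Definition ray_from (c d : R[i]) (F : R[i] -> R[i]) : R[i] :=
  cintegral `]0, +oo[ (fun r => F (c + r%:C * d) * d).

Lemma ray_from0 d F : ray_from 0 d F = ray_integral d F.
Proof.
by congr cintegral; apply/funext => r; rewrite add0r.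
Qed.

(* [haver] maps the whole real line onto [0, 1], so paths parametrized by it need
   no one-sided derivatives at their endpoints. *)
Definition haver s : R := (1 - cos s) / 2.

Lemma haver01 s : 0 <= haver s <= 1.
Proof. by rewrite /haver; have := cos_geN1 s; have := cos_le1 s; lra. Qed.

Lemma haver0 : haver 0 = 0. Proof. by rewrite /haver cos0 subrr mul0r. Qed.

Lemma haverpi : haver pi = 1. Proof. by rewrite /haver cospi opprK; field. Qed.

Lemma is_derive_haver s : is_derive s 1 haver (sin s / 2).
Proof.
have := is_deriveM (is_deriveB (is_derive_cst (1 : R) s (1:R)) (is_derive_cos s))
  (is_derive_cst (2^-1 : R) s (1 : R)).
rewrite (_ : _ + _ = sin s / 2)//.
by rewrite /GRing.scale/=; ring.
Qed.

(** The decay rate 5 is spent as 3 + 2: the derivative of the exponent is cubic, so it costs at most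
    a constant times [expR (3 * r)], and rate 2 is what [cderiv_ray_integral] requires. The distance
    [e] to the pole bounds both the Cauchy factor and its derivative. *)
Lemma cderiv_ray_path a q (c0 c1 d0 d1 : R[i]) (e C : R) : 0 < e ->
  (forall t r, 0 <= t <= 1 -> 0 <= r ->
    e <= cnorm (segment c0 c1 t + r%:C * segment d0 d1 t - q)) ->
  (forall t r, 0 <= t <= 1 -> 0 <= r ->
    cre (quartic a (segment c0 c1 t + r%:C * segment d0 d1 t)) <= C - 5 * r) ->
  forall s, cderiv
    (fun s => ray_from (segment c0 c1 (haver s)) (segment d0 d1 (haver s))
      (cauchy_exp a q)) s
    (- (cauchy_exp a q (segment c0 c1 (haver s)) * ((sin s / 2)%:C * (c1 - c0)))).
Proof.
move=> e0 he hC s.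
have [A A0 hA] := quartic_deriv_bound a.
pose B := 1 + (cnorm c0 + cnorm c1) + (cnorm d0 + cnorm d1).
have B0 : 0 <= B by rewrite /B !addr_ge0 ?cnorm_ge0.
pose K0 := expR C / e.
have K00 : 0 <= K0 by rewrite divr_ge0 ?expR_ge0// ltW.
pose K1 := (A * B ^+ 3 + e^-1) * K0.
have K10 : 0 <= K1.
  by rewrite mulr_ge0// addr_ge0 ?mulr_ge0 ?exprn_ge0// invr_ge0 ltW.
pose K := K0 + K1 + B + cnorm (c1 - c0) + cnorm (d1 - d0).
have [KK0 KK1 KB Kc Kd] : [/\ K0 <= K, K1 <= K, B <= K,
    cnorm (c1 - c0) <= K & cnorm (d1 - d0) <= K].
  have := cnorm_ge0 (c1 - c0); have := cnorm_ge0 (d1 - d0).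
  by rewrite /K => ? ?; split; lra.
have dseg (z0 z1 : R[i]) x :
    cderiv (fun s => segment z0 z1 (haver s)) x ((sin x / 2)%:C * (z1 - z0)).
  have := cderivD (@cderiv_cst R z0 x)
   (cderivM (cderiv_real (is_derive_haver x)) (@cderiv_cst R (z1 - z0) x)).
  by apply: cderiv_eq; rewrite mulr0 addr0 add0r.
have bseg (z0 z1 : R[i]) x : cnorm (z1 - z0) <= K ->
    cnorm ((sin x / 2)%:C * (z1 - z0)) <= K.
  move=> zK; apply: le_trans zK; rewrite cnormM cnorm_real ler_piMl ?cnorm_ge0//.
  rewrite normrM normfV normr_nat.
  have : `|sin x| <= 1 by rewrite ler_norml sin_geN1 sin_le1.
  by lra.
pose gam x r := segment c0 c1 (haver x) + r%:C * segment d0 d1 (haver x).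
have gamq x r : 0 <= r -> gam x r != q.
  move=> r0; rewrite -subr_eq0 -cnorm_eq0 gt_eqF//.
  by apply: (lt_le_trans e0); apply: he => //; exact: haver01.
have bgam x r : 0 <= r -> 1 + cnorm (gam x r) <= B * expR r.
  move=> r0; have er := expR_ge1Dx r; have er1 : 1 <= expR r by lra.
  apply: (@le_trans _ _ (B * (1 + r))); last by rewrite ler_wpM2l.
  have := cnormD (segment c0 c1 (haver x)) (r%:C * segment d0 d1 (haver x)).
  rewrite cnormM cnorm_real ger0_norm// -/(gam x r) => h.
  have hc := segment_bound c0 c1 (haver01 x).
  have hd := segment_bound d0 d1 (haver01 x).
  have {}hd := ler_wpM2l r0 hd.
  have cc : 0 <= r * (cnorm c0 + cnorm c1) by rewrite mulr_ge0 ?addr_ge0 ?cnorm_ge0.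
  have dd : 0 <= cnorm d0 + cnorm d1 by rewrite addr_ge0 ?cnorm_ge0.
  by rewrite /B; lra.
have bF x r : 0 <= r -> cnorm (cauchy_exp a q (gam x r)) <= K0 * expR (- (5 * r)).
  move=> r0; rewrite /cauchy_exp cnormM cnormV cnorm_exp /K0 mulrAC -expRD.
  apply: ler_pM; rewrite ?expR_ge0 ?invr_ge0 ?cnorm_ge0//.
    by rewrite ler_expR hC// haver01.
  have hh : e <= cnorm (gam x r - q) by apply: he => //; exact: haver01.
  by rewrite lef_pV2 ?posrE//; exact: lt_le_trans hh.
apply: (@cderiv_ray_integral R (cauchy_exp a q) (cauchy_exp_deriv a q)
  (fun s => segment c0 c1 (haver s)) (fun s => segment d0 d1 (haver s))
  (fun s => (sin s / 2)%:C * (c1 - c0)) (fun s => (sin s / 2)%:C * (d1 - d0)) K).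
- by move=> x; exact: dseg.
- by move=> x; exact: dseg.
- by move=> x r r0; apply: cholo_cauchy_exp; exact: gamq.
- by move=> x r r0; apply: cholo_cauchy_exp_deriv; exact: gamq.
- move=> x r r0; apply: (le_trans (bF x r r0)).
  apply: ler_pM; rewrite ?expR_ge0//.
  by rewrite ler_expR lerN2; lra.
- move=> x r r0; rewrite /cauchy_exp_deriv cnormM.
  have h1 : cnorm (quartic_deriv a (gam x r) - (gam x r - q)^-1) <=
      (A * B ^+ 3 + e^-1) * expR (3 * r).
    apply: (le_trans (cnormD _ _)); rewrite mulrDl; apply: lerD.
      apply: (le_trans (hA _)); rewrite -mulrA ler_wpM2l//.
      rewrite mulrC (_ : expR (3 * r) = expR r ^+ 3); last by rewrite -expRM_natl.
      rewrite -exprMn mulrC lerXn2r ?nnegrE ?addr_ge0 ?mulr_ge0 ?cnorm_ge0 ?expR_ge0//.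
      exact: bgam.
    rewrite cnormN cnormV.
    have hh : e <= cnorm (gam x r - q) by apply: he => //; exact: haver01.
    apply: (@le_trans _ _ e^-1).
      by rewrite lef_pV2 ?posrE//; exact: lt_le_trans hh.
    rewrite ler_peMr ?invr_ge0 ?(ltW e0)//.
    by have := expR_ge1Dx (3 * r); lra.
  apply: (@le_trans _ _ ((A * B ^+ 3 + e^-1) * expR (3 * r) * (K0 * expR (- (5 * r))))).
    by rewrite ler_pM ?cnorm_ge0// bF.
  rewrite mulrACA -expRD -/K1 (_ : 3 * r - 5 * r = - (2 * r)); last by ring.
  by rewrite ler_wpM2r ?expR_ge0.
- by move=> x; exact: bseg.
- move=> x; apply: (le_trans (segment_bound _ _ (haver01 x))); apply: le_trans KB.
  by have := cnorm_ge0 c0; have := cnorm_ge0 c1; rewrite /B; lra.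
- by move=> x; exact: bseg.
Qed.

Lemma cderiv0_cst (f : R -> R[i]) x y : (forall s, cderiv f s 0) -> f x = f y.
Proof.
move=> df; apply: complexP.
  by apply: (@is_derive_0_is_cst R (cre \o f)) => s; have [] := df s.
by apply: (@is_derive_0_is_cst R (cim \o f)) => s; have [] := df s.
Qed.

Lemma ray_integral_rotate a q (d0 d1 : R[i]) (e C : R) : 0 < e ->
  (forall t r, 0 <= t <= 1 -> 0 <= r -> e <= cnorm (r%:C * segment d0 d1 t - q)) ->
  (forall t r, 0 <= t <= 1 -> 0 <= r ->
    cre (quartic a (r%:C * segment d0 d1 t)) <= C - 5 * r) ->
  ray_integral d0 (cauchy_exp a q) = ray_integral d1 (cauchy_exp a q).
Proof.
move=> e0 he hC.
have s0 t : segment (0 : R[i]) 0 t = 0 by rewrite /segment subr0 mulr0 addr0.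
have h1 t r : 0 <= t <= 1 -> 0 <= r ->
    e <= cnorm (segment 0 0 t + r%:C * segment d0 d1 t - q).
  by move=> ht hr; rewrite s0 add0r; exact: he.
have h2 t r : 0 <= t <= 1 -> 0 <= r ->
    cre (quartic a (segment 0 0 t + r%:C * segment d0 d1 t)) <= C - 5 * r.
  by move=> ht hr; rewrite s0 add0r; exact: hC.
have h := cderiv_ray_path e0 h1 h2.
have z s : - (cauchy_exp a q (segment 0 0 (haver s)) *
    ((sin s / 2)%:C * ((0 : R[i]) - 0))) = 0 by rewrite subrr !mulr0 oppr0.
have := cderiv0_cst 0 pi (fun s => cderiv_eq (z s) (h s)).
by rewrite haver0 haverpi !segment0 !segment1 !ray_from0.
Qed.

Lemma ray_integral_shift a q (d0 d1 : R[i]) (c e C : R) : 0 < e -> 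
  (forall t r d, 0 <= t <= 1 -> 0 <= r -> d = d0 \/ d = d1 ->
     e <= cnorm ((t * c)%:C + r%:C * d - q)) ->
  (forall t r d, 0 <= t <= 1 -> 0 <= r -> d = d0 \/ d = d1 ->
    cre (quartic a ((t * c)%:C + r%:C * d)) <= C - 5 * r) ->
  ray_integral d0 (cauchy_exp a q) - ray_integral d1 (cauchy_exp a q) =
  ray_from c%:C d0 (cauchy_exp a q) - ray_from c%:C d1 (cauchy_exp a q).
Proof.
move=> e0 he hC.
have sc t : segment (0 : R[i]) c%:C t = (t * c)%:C.
  by rewrite /segment subr0 add0r rmorphM.
have sd (d : R[i]) t : segment d d t = d by rewrite /segment subrr mulr0 addr0.
have key d : d = d0 \/ d = d1 -> forall s, cderiv
    (fun s => ray_from (segment 0 c%:C (haver s)) (segment d d (haver s))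
      (cauchy_exp a q)) s
    (- (cauchy_exp a q (segment 0 c%:C (haver s)) * ((sin s / 2)%:C * (c%:C - 0)))).
  move=> dd; apply: (@cderiv_ray_path _ _ _ _ _ _ e C e0) => t r ht hr.
    by rewrite sc sd; exact: he.
  by rewrite sc sd; exact: hC.
have h0 := key d0 (or_introl erefl); have h1 := key d1 (or_intror erefl).
have := cderiv0_cst 0 pi
  (fun s => cderiv_eq (subrr _) (cderivD (h0 s) (cderivN (h1 s)))).
by rewrite haver0 haverpi !segment0 !segment1 !ray_from0.
Qed.

End ContourDeformation.

(** * Complex integrals over the half-line *)

Section ComplexIntegral.
Context {R : realType}.
Local Notation T := (measurableTypeR R).
Local Notation mu := (@lebesgue_measure R).
Local Notation pos := (`]0, +oo[%classic : set T).
Implicit Types (r s t K : R) (f g A B : R -> R) (F G : R -> R[i]).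
Hint Resolve measurable_pos : core.

Definition cintegrable F :=
  rintegrable (fun r => cre (F r)) /\ rintegrable (fun r => cim (F r)).

Lemma cintegrable_dom F g : cmeasurable (F : T -> R[i]) ->
  (forall r, 0 < r -> cnorm (F r) <= g r) -> rintegrable g -> cintegrable F.
Proof.
move=> [m1 m2] Fg ig; split.
  apply: (rintegrable_dom _ _ ig); first exact: measurable_funTS.
  by move=> r r0; apply: le_trans (Fg r r0); exact: cre_le_cnorm.
apply: (rintegrable_dom _ _ ig); first exact: measurable_funTS.
by move=> r r0; apply: le_trans (Fg r r0); exact: cim_le_cnorm.
Qed.

Lemma eq_cintegral F G : (forall r, 0 < r -> F r = G r) ->
  cintegral `]0, +oo[ F = cintegral `]0, +oo[ G.
Proof.
by move=> FG; congr (_ +i* _); apply: eq_Rintegral => r;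
  rewrite inE/= in_itv/= andbT => r0; rewrite FG.
Qed.

Lemma eq_cintegrable F G : (forall r, 0 < r -> F r = G r) ->
  cintegrable F -> cintegrable G.
Proof.
move=> FG [i1 i2]; split.
  move: i1; apply: eq_integrable => // r.
  by rewrite /= inE/= in_itv/= andbT => r0; rewrite FG.
move: i2; apply: eq_integrable => // r.
by rewrite /= inE/= in_itv/= andbT => r0; rewrite FG.
Qed.

Lemma cintegrableZ (c : R[i]) F : cintegrable F -> cintegrable (fun r => c * F r).
Proof.
move=> [i1 i2]; split.
  have := integrableB measurable_pos (integrableZl measurable_pos (cre c) i1)
    (integrableZl measurable_pos (cim c) i2).
  by apply: eq_integrable => // r _; rewrite /= creM.
have := integrableD measurable_pos (integrableZl measurable_pos (cre c) i2)
  (integrableZl measurable_pos (cim c) i1).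
by apply: eq_integrable => // r _; rewrite /= cimM.
Qed.

Lemma cintegralD F G : cintegrable F -> cintegrable G ->
  cintegral `]0, +oo[ (fun r => F r + G r) =
  cintegral `]0, +oo[ F + cintegral `]0, +oo[ G.
Proof.
move=> [F1 F2] [G1 G2]; apply: complexP; rewrite ?creD ?cimD /=.
  under eq_Rintegral do rewrite creD.
  exact: RintegralD.
under eq_Rintegral do rewrite cimD.
exact: RintegralD.
Qed.

Lemma cintegrableD F G : cintegrable F -> cintegrable G ->
  cintegrable (fun r => F r + G r).
Proof.
move=> [F1 F2] [G1 G2]; split.
  have := integrableD measurable_pos F1 G1.
  by apply: eq_integrable => // r _; rewrite /= creD.
have := integrableD measurable_pos F2 G2.
by apply: eq_integrable => // r _; rewrite /= cimD.
Qed.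

Lemma cintegralZ (c : R[i]) F : cintegrable F ->
  cintegral `]0, +oo[ (fun r => c * F r) = c * cintegral `]0, +oo[ F.
Proof.
move=> [F1 F2]; apply: complexP; rewrite ?creM ?cimM /=.
  under eq_Rintegral do rewrite creM.
  rewrite RintegralB ?RintegralZl//; first exact: rintegrableZ F1.
  exact: rintegrableZ F2.
under eq_Rintegral do rewrite cimM.
rewrite RintegralD ?RintegralZl//; first exact: rintegrableZ F2.
exact: rintegrableZ F1.
Qed.

Lemma cintegralN F : cintegrable F ->
  cintegral `]0, +oo[ (fun r => - F r) = - cintegral `]0, +oo[ F.
Proof.
move=> iF; rewrite -mulN1r -cintegralZ//.
by apply: eq_cintegral => r _; rewrite mulN1r.
Qed.

Lemma cintegrableN F : cintegrable F -> cintegrable (fun r => - F r).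
Proof.
move=> /(cintegrableZ (-1)); congr cintegrable; apply/funext => r.
by rewrite mulN1r.
Qed.

Lemma cintegralB (F G : R -> R[i]) : cintegrable F -> cintegrable G ->
  cintegral `]0, +oo[ (fun r => F r - G r) =
  cintegral `]0, +oo[ F - cintegral `]0, +oo[ G.
Proof. by move=> iF iG; rewrite cintegralD ?cintegralN//; exact: cintegrableN. Qed.

(** Shaped after the four Pearcey rays: the right pair and the left pair, each with opposite
    orientations. *)
Lemma cintegral_BDB (F G H K : R -> R[i]) :
  cintegrable F -> cintegrable G -> cintegrable H -> cintegrable K ->
  cintegral `]0, +oo[ (fun r => F r - G r + (H r - K r)) =
  cintegral `]0, +oo[ F - cintegral `]0, +oo[ G +
  (cintegral `]0, +oo[ H - cintegral `]0, +oo[ K).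
Proof.
move=> iF iG iH iK; rewrite cintegralD ?cintegralB//.
  exact: cintegrableD iF (cintegrableN iG).
exact: cintegrableD iH (cintegrableN iK).
Qed.

(** The factor 2 is the price of estimating the real and imaginary parts separately. *)
Lemma cnorm_cintegral F g : cintegrable F -> rintegrable g ->
  (forall r, 0 < r -> cnorm (F r) <= g r) ->
  cnorm (cintegral `]0, +oo[ F) <= 2 * \int[mu]_(r in pos) g r.
Proof.
move=> [F1 F2] ig Fg; apply: (le_trans (cnorm_le_re_im _)).
rewrite mulrDl mul1r /cintegral/=; apply: lerD.
  apply: (le_trans (le_normr_Rintegral _ F1)) => //.
  apply: le_Rintegral => //; first exact: integrable_norm.
  move=> r; rewrite /= in_itv/= andbT => r0.
  by apply: le_trans (Fg r r0); exact: cre_le_cnorm.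
apply: (le_trans (le_normr_Rintegral _ F2)) => //.
apply: le_Rintegral => //; first exact: integrable_norm.
move=> r; rewrite /= in_itv/= andbT => r0.
by apply: le_trans (Fg r r0); exact: cim_le_cnorm.
Qed.

Definition ccvg (u : nat -> R[i]) (l : R[i]) :=
  cre (u n) @[n --> \oo] --> cre l /\ cim (u n) @[n --> \oo] --> cim l.

Lemma rdominated_cvg (f_ : nat -> R -> R) f g :
  (forall n, measurable_fun pos (f_ n)) ->
  (forall r, 0 < r -> f_ n r @[n --> \oo] --> f r) ->
  (forall n r, 0 < r -> `|f_ n r| <= g r) -> rintegrable g ->
  \int[mu]_(r in pos) f_ n r @[n --> \oo] --> \int[mu]_(r in pos) f r.
Proof.
move=> mf ff fg ig.
have mlim : measurable_fun pos (EFin \o f).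
  apply: (emeasurable_fun_cvg (fun n => EFin \o f_ n)).
    by move=> n; apply/measurable_EFinP; exact: mf.
  move=> r; rewrite /= in_itv/= andbT => r0.
  by apply: cvg_EFin; [exact: nearW|exact: ff].
have mf' n : measurable_fun pos (EFin \o f_ n) by apply/measurable_EFinP; exact: mf.
have cv : {ae mu, forall x, pos x -> (EFin \o f_ n) x @[n --> \oo] --> (EFin \o f) x}.
  apply: aeW => r; rewrite /= in_itv/= andbT => r0.
  by apply: cvg_EFin; [exact: nearW|exact: ff].
have bd : {ae mu, forall x n, pos x -> (`|(EFin \o f_ n) x| <= (EFin \o g) x)%E}.
  by apply: aeW => r n; rewrite /= in_itv/= andbT => r0; rewrite lee_fin fg.
have [ilim _ cvgi] := dominated_convergence measurable_pos mf' mlim cv ig bd.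
have /fineK fi : (\int[mu]_(x in pos) (EFin \o f) x)%E \is a fin_num.
  exact: integrable_fin_num.
by apply: fine_cvg; rewrite /Rintegral fi.
Qed.

Lemma cdominated_cvg (F_ : nat -> R -> R[i]) F g :
  (forall n, cintegrable (F_ n)) ->
  (forall r, 0 < r -> ccvg (fun n => F_ n r) (F r)) ->
  (forall n r, 0 < r -> cnorm (F_ n r) <= g r) -> rintegrable g ->
  ccvg (fun n => cintegral `]0, +oo[ (F_ n)) (cintegral `]0, +oo[ F).
Proof.
move=> iF FF Fg ig; split; rewrite /cintegral/=.
  apply: rdominated_cvg ig.
  - by move=> n; have [/integrableP[/measurable_EFinP]] := iF n.
  - by move=> r /FF[].
  - by move=> n r r0; apply: le_trans (Fg n r r0); exact: cre_le_cnorm.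
apply: rdominated_cvg ig.
- by move=> n; have [_ /integrableP[/measurable_EFinP]] := iF n.
- by move=> r /FF[].
- by move=> n r r0; apply: le_trans (Fg n r r0); exact: cim_le_cnorm.
Qed.

(** A majorant in product form is integrable on the product space, because its iterated integral is
    a product of two finite integrals. *)
Lemma rfubini (f : T * T -> R) A B : measurable_fun setT f ->
  rintegrable A -> rintegrable B ->
  (forall x y, 0 < x -> 0 < y -> `|f (x, y)| <= A x * B y) ->
  rintegrable (fun x => \int[mu]_(y in pos) f (x, y)) /\
  \int[mu]_(x in pos) \int[mu]_(y in pos) f (x, y) =
  \int[mu]_(y in pos) \int[mu]_(x in pos) f (x, y).
Proof.
move=> mf iA iB fAB.
pose A' : T -> R := A \_ pos; pose B' : T -> R := B \_ pos.
have iA' : mu.-integrable setT (EFin \o A').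
  by rewrite -restrict_EFin; exact: (@integrable_mkcond _ T R (@lebesgue_measure R) pos (EFin \o A) measurable_pos).1 iA.
have iB' : mu.-integrable setT (EFin \o B').
  by rewrite -restrict_EFin; exact: (@integrable_mkcond _ T R (@lebesgue_measure R) pos (EFin \o B) measurable_pos).1 iB.
have mA' : measurable_fun setT A' by have /integrableP[/measurable_EFinP] := iA'.
have mB' : measurable_fun setT B' by have /integrableP[/measurable_EFinP] := iB'.
pose g (z : T * T) : \bar R := (A' z.1 * B' z.2)%:E.
have mg : measurable_fun setT g.
  apply/measurable_EFinP; apply: measurable_funM.
    exact: (measurableT_comp mA' measurable_fst).
  exact: (measurableT_comp mB' measurable_snd).
have ig : (mu \x mu)%E.-integrable setT g.
  apply/(integrable12ltyP _ _ mg).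
  have /integrableP[_ fA] := iA'; have /integrableP[_ fB] := iB'.
  rewrite (eq_integral (fun x => (`|A' x|%:E *
      \int[mu]_y `|(EFin \o B') y|)%E)); last first.
    move=> x _; rewrite -ge0_integralZl//=; last first.
      by apply/measurable_EFinP; exact: measurableT_comp.
    by apply: eq_integral => y _; rewrite normrM EFinM.
  have /fineK <- : (\int[mu]_y `|(EFin \o B') y|)%E \is a fin_num.
    by rewrite ge0_fin_numE// integral_ge0.
  rewrite ge0_integralZr//=; last 2 first.
  - by apply/measurable_EFinP; exact: measurableT_comp.
  - by rewrite lee_fin fine_ge0// integral_ge0.
  apply: lte_mul_pinfty; rewrite ?ge0_fin_numE ?integral_ge0//.
  exact: ltry.
(* The bound on [f] holds in the open quadrant only, so [f] is cut off there before Fubini is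
   applied on the whole plane. *)
pose F (z : T * T) : \bar R := (f z * \1_pos z.1 * \1_pos z.2)%:E.
have mF : measurable_fun setT F.
  apply/measurable_EFinP; apply: measurable_funM; first apply: measurable_funM => //.
    exact: (measurableT_comp (measurable_indic measurable_pos) measurable_fst).
  exact: (measurableT_comp (measurable_indic measurable_pos) measurable_snd).
have iF : (mu \x mu)%E.-integrable setT F.
  apply: (le_integrable measurableT mF _ ig) => -[x y] _ /=.
  rewrite lee_fin !normrM /A' /B' !patchE !indicE.
  have [|] := boolP (x \in pos); last by rewrite !(normr0, mulr0, mul0r).
  rewrite normr1 mulr1 inE/= in_itv/= andbT => x0.
  have [|] := boolP (y \in pos); last by rewrite !(normr0, mulr0, mul0r).
  rewrite normr1 mulr1 inE/= in_itv/= andbT => y0.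
  by rewrite -normrM (le_trans (fAB x y x0 y0))// ler_norm.
have FE x : (\int[mu]_y F (x, y))%E =
    ((fun x => \int[mu]_(y in pos) (f (x, y))%:E)%E \_ pos) x.
  rewrite patchE; have [|] := boolP (x \in pos) => xp.
    rewrite [RHS]integral_mkcond; apply: eq_integral => y _.
    rewrite /F/= !indicE xp mulr1 patchE.
    by case: ifP; rewrite ?mulr1 ?mulr0.
  rewrite integral0_eq// => y _; rewrite /F/= !indicE (negbTE xp).
  by rewrite mulr0 mul0r.
have GE y : (\int[mu]_x F (x, y))%E =
    ((fun y => \int[mu]_(x in pos) (f (x, y))%:E)%E \_ pos) y.
  rewrite patchE; have [|] := boolP (y \in pos) => yp.
    rewrite [RHS]integral_mkcond; apply: eq_integral => x _.
    rewrite /F/= !indicE yp mulr1 patchE.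
    by case: ifP; rewrite ?mulr1 ?mulr0.
  rewrite integral0_eq// => x _; rewrite /F/= !indicE (negbTE yp).
  by rewrite mulr0.
(* [Rintegral] applies [fine], which loses nothing only where the inner integrals are finite. *)
have fin1 x : 0 < x -> (\int[mu]_(y in pos) (f (x, y))%:E)%E \is a fin_num.
  move=> x0; apply: integrable_fin_num => //.
  apply: (@rintegrable_dom R (fun y => f (x, y)) _ _ _ (rintegrableZ (A x) iB)).
    by apply: measurable_funTS; exact: (measurableT_comp mf (measurable_pair1 x)).
  by move=> r r0; exact: fAB.
have fin2 y : 0 < y -> (\int[mu]_(x in pos) (f (x, y))%:E)%E \is a fin_num.
  move=> y0; apply: integrable_fin_num => //.
  apply: (@rintegrable_dom R (fun x => f (x, y)) _ _ _ (rintegrableZ (B y) iA)).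
    by apply: measurable_funTS; exact: (measurableT_comp mf (measurable_pair2 y)).
  by move=> r r0; rewrite mulrC; exact: fAB.
split.
  have := integrable_fubini_F iF; rewrite /fubini_F.
  under [X in _.-integrable _ X]eq_fun do rewrite FE.
  move=> /(integrable_mkcond _ measurable_pos).2.
  apply: eq_integrable => // x; rewrite inE/= in_itv/= andbT => x0.
  by rewrite /Rintegral fineK// fin1.
have := Fubini iF.
under eq_integral do rewrite FE.
under [RHS]eq_integral do rewrite GE.
rewrite -!integral_mkcond => e.
rewrite {1 3}/Rintegral; apply: (@eq_trans _ _
   (fine (\int[mu]_(x in pos) \int[mu]_(y in pos) (f (x, y))%:E)%E)).
  congr fine; apply: eq_integral => x; rewrite inE/= in_itv/= andbT => x0.
  by rewrite /Rintegral fineK// fin1.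
rewrite e; congr fine; apply: eq_integral => x; rewrite inE/= in_itv/= andbT => x0.
by rewrite /Rintegral fineK// fin2.
Qed.

Lemma cfubini (F : T * T -> R[i]) A B : cmeasurable F ->
  rintegrable A -> rintegrable B ->
  (forall x y, 0 < x -> 0 < y -> cnorm (F (x, y)) <= A x * B y) ->
  cintegrable (fun x => cintegral `]0, +oo[ (fun y => F (x, y))) /\
  cintegral `]0, +oo[ (fun x => cintegral `]0, +oo[ (fun y => F (x, y))) =
  cintegral `]0, +oo[ (fun y => cintegral `]0, +oo[ (fun x => F (x, y))).
Proof.
move=> [m1 m2] iA iB FAB.
have [i1 e1] := rfubini (f := fun z => cre (F z)) m1 iA iB
  (fun x y x0 y0 => le_trans (cre_le_cnorm _) (FAB x y x0 y0)).
have [i2 e2] := rfubini (f := fun z => cim (F z)) m2 iA iB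
  (fun x y x0 y0 => le_trans (cim_le_cnorm _) (FAB x y x0 y0)).
by split; [split|apply: complexP; [exact: e1|exact: e2]].
Qed.

End ComplexIntegral.

(** * Decay of the exponentials *)

Section Decay.
Context {R : realType}.
Implicit Types (r s t K : R) (d z w : R[i]).

Lemma cre_quartic (a : R * R * R * R) z : cre (quartic a z) =
  a.1.1.1 * cre (z ^+ 4) + a.1.1.2 * cre (z ^+ 3) + a.1.2 * cre (z ^+ 2)
  + a.2 * cre z.
Proof. by rewrite /quartic !creD !rmulC. Qed.

Lemma cre_exp2 z : cre (z ^+ 2) = cre z ^+ 2 - cim z ^+ 2.
Proof. by rewrite !expr2 creM. Qed.

Lemma cre_exp3 z : cre (z ^+ 3) = cre z ^+ 3 - 3 * cre z * cim z ^+ 2.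
Proof.
case: z => x y; rewrite !exprS !expr0 !mulr1 !(creM, cimM) /=.
by ring.
Qed.

Lemma cre_exp4 z :
  cre (z ^+ 4) = cre z ^+ 4 - 6 * cre z ^+ 2 * cim z ^+ 2 + cim z ^+ 4.
Proof.
case: z => x y; rewrite !exprS !expr0 !mulr1 !(creM, cimM) /=.
by ring.
Qed.

Lemma cre_exp_le z n : `|cre (z ^+ n)| <= cnorm z ^+ n.
Proof. by rewrite -cnormX cre_le_cnorm. Qed.

(** Up to [N] the quartic term is dropped and the rest is increasing. Beyond [N] the quartic term
    exceeds the sum of the others; the [+ 1] in [N] ensures [1 <= n], so that all lower powers are
    at most [n ^+ 3]. *)
Lemma quartic_decay (k A3 A2 A1 : R) : 0 < k -> 0 <= A3 -> 0 <= A2 -> 0 <= A1 ->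
  exists C, forall n, 0 <= n ->
    - k * n ^+ 4 + A3 * n ^+ 3 + A2 * n ^+ 2 + A1 * n <= C.
Proof.
move=> k0 a3 a2 a1; pose N := (A3 + A2 + A1) / k + 1.
have N1 : 1 <= N by rewrite lerDr divr_ge0 ?addr_ge0// ltW.
have kN : A3 + A2 + A1 <= k * N.
  by rewrite /N mulrDr mulr1 mulrC divfK ?gt_eqF// lerDl ltW.
exists (A3 * N ^+ 3 + A2 * N ^+ 2 + A1 * N) => n n0.
have N0 : 0 <= N by lra.
have [nN|Nn] := leP n N.
  have h3 : A3 * n ^+ 3 <= A3 * N ^+ 3 by rewrite ler_wpM2l// lerXn2r.
  have h2 : A2 * n ^+ 2 <= A2 * N ^+ 2 by rewrite ler_wpM2l// lerXn2r.
  have h1 : A1 * n <= A1 * N by rewrite ler_wpM2l.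
  have h4 : 0 <= k * n ^+ 4 by rewrite mulr_ge0 ?exprn_ge0// ltW.
  lra.
apply: (@le_trans _ _ 0); last by rewrite !addr_ge0 ?mulr_ge0 ?exprn_ge0.
have n1 : 1 <= n by lra.
have h3 : n ^+ 2 <= n ^+ 3 by rewrite (exprS _ 2) ler_peMl ?exprn_ge0.
have h2 : n <= n ^+ 2 by rewrite expr2 ler_peMl.
have hk : (A3 + A2 + A1) * n ^+ 3 <= k * n ^+ 4.
  rewrite (_ : k * n ^+ 4 = k * n * n ^+ 3); last by ring.
  rewrite ler_wpM2r ?exprn_ge0//.
  by apply: (le_trans kN); rewrite ler_wpM2l ?ltW.
have g2 : A2 * n ^+ 2 <= A2 * n ^+ 3 by rewrite ler_wpM2l.
have g1 : A1 * n <= A1 * n ^+ 3 by rewrite ler_wpM2l//; lra.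
lra.
Qed.

Lemma cubic_decay (k A2 A1 : R) : 0 < k -> 0 <= A2 -> 0 <= A1 ->
  exists C, forall n, 0 <= n -> - k * n ^+ 3 + A2 * n ^+ 2 + A1 * n <= C.
Proof.
move=> k0 a2 a1; pose N := (A2 + A1) / k + 1.
have N1 : 1 <= N by rewrite lerDr divr_ge0 ?addr_ge0// ltW.
have kN : A2 + A1 <= k * N.
  by rewrite /N mulrDr mulr1 mulrC divfK ?gt_eqF// lerDl ltW.
exists (A2 * N ^+ 2 + A1 * N) => n n0.
have N0 : 0 <= N by lra.
have [nN|Nn] := leP n N.
  have h2 : A2 * n ^+ 2 <= A2 * N ^+ 2 by rewrite ler_wpM2l// lerXn2r.
  have h1 : A1 * n <= A1 * N by rewrite ler_wpM2l.
  have h4 : 0 <= k * n ^+ 3 by rewrite mulr_ge0 ?exprn_ge0// ltW.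
  lra.
apply: (@le_trans _ _ 0); last by rewrite !addr_ge0 ?mulr_ge0 ?exprn_ge0.
have n1 : 1 <= n by lra.
have h2 : n <= n ^+ 2 by rewrite expr2 ler_peMl.
have hk : (A2 + A1) * n ^+ 2 <= k * n ^+ 3.
  rewrite (_ : k * n ^+ 3 = k * n * n ^+ 2); last by ring.
  rewrite ler_wpM2r ?exprn_ge0//.
  by apply: (le_trans kN); rewrite ler_wpM2l ?ltW.
have g1 : A1 * n <= A1 * n ^+ 2 by rewrite ler_wpM2l.
lra.
Qed.

Let term_le (c r B : R) d n : 0 <= r -> cnorm d <= B ->
  c * cre ((r%:C * d) ^+ n) <= `|c| * B ^+ n * r ^+ n.
Proof.
move=> r0 dB; rewrite exprMn -rmorphXn rmulC /= mulrCA mulrC.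
rewrite ler_wpM2r ?exprn_ge0//.
apply: (le_trans (ler_norm _)); rewrite normrM ler_wpM2l//.
apply: (le_trans (cre_exp_le _ _)).
have B0 : 0 <= B := le_trans (cnorm_ge0 d) dB.
by rewrite lerXn2r ?nnegrE ?cnorm_ge0.
Qed.

(** [C] is chosen before the direction, so one bound serves all directions met during a
    deformation. *)
Lemma ray_decay4 (a : R * R * R * R) (k B : R) : 0 < k -> 0 <= B ->
  exists C, forall d r, cnorm d <= B -> a.1.1.1 * cre (d ^+ 4) <= - k ->
    0 <= r -> cre (quartic a (r%:C * d)) <= C - 5 * r.
Proof.
move=> k0 B0.
have p3 : 0 <= `|a.1.1.2| * B ^+ 3 by rewrite mulr_ge0 ?exprn_ge0.
have p2 : 0 <= `|a.1.2| * B ^+ 2 by rewrite mulr_ge0 ?exprn_ge0.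
(* The 5 added to the linear coefficient pays for the margin [5 * r]. *)
have p1 : 0 <= `|a.2| * B + 5 by rewrite addr_ge0 ?mulr_ge0.
have [C hC] := quartic_decay k0 p3 p2 p1.
exists C => d r dB h4 r0; have := hC r r0.
rewrite cre_quartic.
have b3 := term_le a.1.1.2 3 r0 dB; have b2 := term_le a.1.2 2 r0 dB.
have := term_le a.2 1 r0 dB; rewrite !expr1 => b1.
have b4 : a.1.1.1 * cre ((r%:C * d) ^+ 4) <= - k * r ^+ 4.
  rewrite exprMn -rmorphXn rmulC /= mulrCA mulrC ler_wpM2r ?exprn_ge0//.
lra.
Qed.

(** The decay comes from the cubic term alone; of the quartic term only the sign matters. Since [C]
    is chosen before [c4], the bound is uniform in [eps]. *)
Lemma ray_decay3 (c2 c1 k B : R) : 0 < k -> 0 <= B ->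
  exists C, forall (c4 c3 : R) d r, cnorm d <= B -> c4 * cre (d ^+ 4) <= 0 ->
    c3 * cre (d ^+ 3) <= - k ->
    0 <= r -> cre (quartic (c4, c3, c2, c1) (r%:C * d)) <= C - 5 * r.
Proof.
move=> k0 B0.
have p2 : 0 <= `|c2| * B ^+ 2 by rewrite mulr_ge0 ?exprn_ge0.
have p1 : 0 <= `|c1| * B + 5 by rewrite addr_ge0 ?mulr_ge0.
have [C hC] := cubic_decay k0 p2 p1.
exists C => c4 c3 d r dB h4 h3 r0; have := hC r r0.
rewrite cre_quartic/=.
have b2 := term_le c2 2 r0 dB; have := term_le c1 1 r0 dB; rewrite !expr1 => b1.
have b4 : c4 * cre ((r%:C * d) ^+ 4) <= 0.
  by rewrite exprMn -rmorphXn rmulC /= mulrCA mulr_ge0_le0 ?exprn_ge0.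
have b3 : c3 * cre ((r%:C * d) ^+ 3) <= - k * r ^+ 3.
  by rewrite exprMn -rmorphXn rmulC /= mulrCA mulrC ler_wpM2r ?exprn_ge0.
lra.
Qed.

Definition kernel_integrand (p q : R * R * R * R) z w : R[i] :=
  cexp (quartic p z) * cexp (quartic q w) / (z - w).

(** The Cauchy factor supplies the square roots in the two [halfpow], and the exponential decay
    supplies the factors [(1 + r)^-1] and [(1 + s)^-1]. *)
Lemma kernel_integrand_le p q z w (e C1 C2 : R) r s :
  0 < e -> 0 < r -> 0 < s -> e * (r + s) <= cnorm (z - w) ->
  cre (quartic p z) <= C1 - 5 * r -> cre (quartic q w) <= C2 - 5 * s ->
  cnorm (kernel_integrand p q z w) <= expR (C1 + C2) / e * halfpow r * halfpow s.
Proof.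
move=> e0 r0 s0 zw hz hw.
have h x : 0 < x -> expR (- (5 * x)) <= (1 + x)^-1.
  move=> x0; rewrite expRN lef_pV2 ?posrE ?expR_gt0 ?addr_gt0//.
  by have := expR_ge1Dx (5 * x); lra.
have rs : Num.sqrt r * Num.sqrt s <= r + s.
  have := sqr_sqrtr (ltW r0); have := sqr_sqrtr (ltW s0).
  have := sqr_ge0 (Num.sqrt r - Num.sqrt s).
  have := mulr_ge0 (sqrtr_ge0 r) (sqrtr_ge0 s).
  by rewrite sqrrB -mulr_natl; lra.
have qrs : 0 < Num.sqrt r * Num.sqrt s by rewrite mulr_gt0 ?sqrtr_gt0.
have -> : expR (C1 + C2) / e * halfpow r * halfpow s =
  (expR C1 * (1 + r)^-1) * (expR C2 * (1 + s)^-1) * (e * (Num.sqrt r * Num.sqrt s))^-1.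
  rewrite /halfpow expRD; field.
  by rewrite ?gt_eqF ?sqrtr_gt0 ?addr_gt0.
rewrite /kernel_integrand cnormM cnormV cnormM !cnorm_exp.
apply: ler_pM; rewrite ?mulr_ge0 ?expR_ge0 ?invr_ge0 ?cnorm_ge0//.
  apply: ler_pM; rewrite ?expR_ge0//.
    apply: (@le_trans _ _ (expR (C1 - 5 * r))); first by rewrite ler_expR.
    by rewrite expRD ler_wpM2l ?expR_ge0// h.
  apply: (@le_trans _ _ (expR (C2 - 5 * s))); first by rewrite ler_expR.
  by rewrite expRD ler_wpM2l ?expR_ge0// h.
rewrite lef_pV2 ?posrE.
- by apply: le_trans zw; rewrite ler_wpM2l// ltW.
- by apply: lt_le_trans zw; rewrite mulr_gt0// addr_gt0.
- by rewrite mulr_gt0.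
Qed.

End Decay.

(** * Double integrals over rays *)

Section DoubleIntegral.
Context {R : realType}.
Local Notation T := (measurableTypeR R).
Local Notation mu := (@lebesgue_measure R).
Local Notation coefs := (R * R * R * R)%type.
Implicit Types (r s t c C : R) (d e z w : R[i]) (a p q : coefs).

(* The margin [5 * r] leaves room for the polynomial factors that appear when the
   contours are deformed. *)
Definition tempered a d C :=
  forall r, 0 <= r -> cre (quartic a (r%:C * d)) <= C - 5 * r.

(** A quantitative form of the rays meeting only at 0. The bound is linear in [r + s] because both
    rays start there, so that no constant bound is possible. *)
Definition ray_separated d e c :=
  forall r s, 0 <= r -> 0 <= s -> c * (r + s) <= cnorm (r%:C * d - s%:C * e).

Definition double_integral p q d e :=
  ray_integral d (fun z => ray_integral e (kernel_integrand p q z)).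

Lemma kernel_cauchyl p q z w :
  kernel_integrand p q z w = - cexp (quartic p z) * cauchy_exp q z w.
Proof.
rewrite /kernel_integrand /cauchy_exp -(opprB w z) invrN.
by ring.
Qed.

Lemma kernel_cauchyr p q z w :
  kernel_integrand p q z w = cexp (quartic q w) * cauchy_exp p w z.
Proof. by rewrite /kernel_integrand /cauchy_exp; ring. Qed.

Section Measurability.
Context {d0 : measure_display} {Y : measurableType d0}.

Lemma cmeas_quartic a (f : Y -> R[i]) : cmeasurable f ->
  cmeasurable (fun y => quartic a (f y)).
Proof.
move=> mf; have m k n : cmeasurable (fun y => k%:C * f y ^+ n).
  by apply: cmeasM; [exact: cmeas_cst|exact: cmeasX].
exact: (cmeasD (cmeasD (cmeasD (m _ 4) (m _ 3)) (m _ 2))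
  (cmeasM (cmeas_cst _) mf)).
Qed.

Lemma cmeas_kernel p q (f g : Y -> R[i]) : cmeasurable f -> cmeasurable g ->
  cmeasurable (fun y => kernel_integrand p q (f y) (g y)).
Proof.
move=> mf mg; apply: cmeasM; last by apply: cmeasV; exact: cmeasB.
by apply: cmeasM; apply: cmeas_exp; exact: cmeas_quartic.
Qed.

Lemma cmeas_cauchy a z (f : Y -> R[i]) : cmeasurable f ->
  cmeasurable (fun y => cauchy_exp a z (f y)).
Proof.
move=> mf; apply: cmeasM; first by apply: cmeas_exp; exact: cmeas_quartic.
by apply: cmeasV; apply: cmeasB => //; exact: cmeas_cst.
Qed.

End Measurability.

Lemma cmeas_ray c d : cmeasurable (fun r : T => c%:C + r%:C * d).
Proof.
apply: cmeasD; first exact: cmeas_cst.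
by apply: cmeasM; [apply: cmeas_real; exact: measurable_id|exact: cmeas_cst].
Qed.

Lemma cintegrable_cauchy a z c d (b C : R) : 0 < b ->
  (forall r, 0 <= r -> b <= cnorm (c%:C + r%:C * d - z)) ->
  (forall r, 0 <= r -> cre (quartic a (c%:C + r%:C * d)) <= C - 5 * r) ->
  (forall r, 0 < r -> cnorm (cauchy_exp a z (c%:C + r%:C * d) * d) <=
    expR C / b * cnorm d * expR (- r)) /\
  cintegrable (fun r => cauchy_exp a z (c%:C + r%:C * d) * d).
Proof.
move=> b0 hb hC.
have h r : 0 < r -> cnorm (cauchy_exp a z (c%:C + r%:C * d) * d) <=
    expR C / b * cnorm d * expR (- r).
  move=> /ltW r0; rewrite cnormM mulrAC ler_wpM2r ?cnorm_ge0//.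
  rewrite /cauchy_exp cnormM cnormV cnorm_exp mulrAC -expRD.
  apply: ler_pM; rewrite ?expR_ge0 ?invr_ge0 ?cnorm_ge0//.
    by rewrite ler_expR (le_trans (hC r r0))//; lra.
  by rewrite lef_pV2 ?posrE ?hb//; exact: lt_le_trans (hb r r0).
split => //; apply: (cintegrable_dom _ h); last exact/rintegrableZ/rintegrable_expN.
by apply: cmeasM; [apply: cmeas_cauchy; exact: cmeas_ray|exact: cmeas_cst].
Qed.

Lemma ray_integral_kernel p q z d (b C : R) : 0 < b ->
  (forall r, 0 <= r -> b <= cnorm (r%:C * d - z)) -> tempered q d C ->
  ray_integral d (kernel_integrand p q z) =
  - cexp (quartic p z) * ray_integral d (cauchy_exp q z).
Proof.
move=> b0 hb hC; rewrite -cintegralZ.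
  apply: eq_cintegral => r r0; rewrite kernel_cauchyl mulrA//.
have [||_ iF] := @cintegrable_cauchy q z 0 d b C b0.
- by move=> r r0; rewrite add0r hb.
- by move=> r r0; rewrite add0r hC.
by move: iF; congr cintegrable; apply/funext => r; rewrite add0r.
Qed.

Lemma ray_integral_kernelr p q w d (b C : R) : 0 < b ->
  (forall r, 0 <= r -> b <= cnorm (r%:C * d - w)) -> tempered p d C ->
  ray_integral d (fun z => kernel_integrand p q z w) =
  cexp (quartic q w) * ray_integral d (cauchy_exp p w).
Proof.
move=> b0 hb hC; rewrite -cintegralZ.
  by apply: eq_cintegral => r r0; rewrite kernel_cauchyr mulrA.
have [||_ iF] := @cintegrable_cauchy p w 0 d b C b0.
- by move=> r r0; rewrite add0r hb.
- by move=> r r0; rewrite add0r hC.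
by move: iF; congr cintegrable; apply/funext => r; rewrite add0r.
Qed.

Lemma separated_sym d e c : ray_separated d e c -> ray_separated e d c.
Proof. by move=> h r s r0 s0; rewrite addrC -opprB cnormN; exact: h. Qed.

(** Freezing one variable at a nonzero point turns separation into a positive distance from the
    other ray to the pole, as the deformation of a single ray requires. *)
Lemma separatedl d e c r : 0 < c -> ray_separated d e c -> 0 < r ->
  0 < c * r /\ forall s, 0 <= s -> c * r <= cnorm (s%:C * e - r%:C * d).
Proof.
move=> c0 h r0; split; first by rewrite mulr_gt0.
move=> s s0; rewrite -opprB cnormN; apply: le_trans (h r s (ltW r0) s0).
by rewrite ler_wpM2l ?(ltW c0)// lerDl.
Qed.

(** Makes [z] the inner variable, so that its ray can be deformed for fixed [w]. The integrability
    of the outer integrand serves to add up the contributions of several rays. *)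
Lemma double_integral_swap p q d e c C1 C2 : 0 < c -> ray_separated d e c ->
  tempered p d C1 -> tempered q e C2 ->
  cintegrable (fun r => ray_integral e (kernel_integrand p q (r%:C * d)) * d) /\
  double_integral p q d e =
  cintegral `]0, +oo[
    (fun s => ray_integral d (fun z => kernel_integrand p q z (s%:C * e)) * e).
Proof.
move=> c0 sep tp tq.
pose F (x : T * T) := kernel_integrand p q (x.1%:C * d) (x.2%:C * e) * (d * e).
have mF : cmeasurable F.
  apply: cmeasM; last exact: cmeas_cst.
  apply: cmeas_kernel; apply: cmeasM; try exact: cmeas_cst.
    by apply: cmeas_real; exact: measurable_fst.
  by apply: cmeas_real; exact: measurable_snd.
pose K := expR (C1 + C2) / c * (cnorm d * cnorm e).
have iA : rintegrable (fun r : R => K * halfpow r).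
  exact/rintegrableZ/rintegrable_halfpow.
have FAB x y : 0 < x -> 0 < y -> cnorm (F (x, y)) <= K * halfpow x * halfpow y.
  move=> x0 y0; rewrite /F /= cnormM (cnormM d e).
  apply: (@le_trans _ _ (expR (C1 + C2) / c * halfpow x * halfpow y *
    (cnorm d * cnorm e))).
    rewrite ler_wpM2r ?mulr_ge0 ?cnorm_ge0//.
    by apply: kernel_integrand_le => //; [apply: sep|apply: tp|apply: tq]; exact: ltW.
  by rewrite le_eqVlt /K; apply/orP; left; apply/eqP; ring.
have [i1 e1] := cfubini mF iA rintegrable_halfpow FAB.
have E1 r : 0 < r -> ray_integral e (kernel_integrand p q (r%:C * d)) * d =
    cintegral `]0, +oo[ (fun s => F (r, s)).
  move=> r0; have [b0 hb] := separatedl c0 sep r0.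
  rewrite (ray_integral_kernel _ b0 hb tq) mulrAC -cintegralZ.
    by apply: eq_cintegral => s _; rewrite /F/= kernel_cauchyl; ring.
  have [||_ iF] := @cintegrable_cauchy q (r%:C * d) 0 e _ C2 b0.
  - by move=> s s0; rewrite add0r hb.
  - by move=> s s0; rewrite add0r tq.
  by move: iF; congr cintegrable; apply/funext => s; rewrite add0r.
have E2 s : 0 < s -> ray_integral d (fun z => kernel_integrand p q z (s%:C * e)) * e =
    cintegral `]0, +oo[ (fun r => F (r, s)).
  move=> s0; have [b0 hb] := separatedl c0 (separated_sym sep) s0.
  rewrite (ray_integral_kernelr _ b0 hb tp) mulrAC -cintegralZ.
    by apply: eq_cintegral => r _; rewrite /F/= kernel_cauchyr; ring.
  have [||_ iF] := @cintegrable_cauchy p (s%:C * e) 0 d _ C1 b0.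
  - by move=> r r0; rewrite add0r hb.
  - by move=> r r0; rewrite add0r tp.
  by move: iF; congr cintegrable; apply/funext => r; rewrite add0r.
split; first by apply: eq_cintegrable i1 => r r0; rewrite E1.
rewrite /double_integral /ray_integral (eq_cintegral E1) e1.
by apply: eq_cintegral => s s0; rewrite E2.
Qed.

(** After the exchange, each [w = s e] with [0 < s] is at distance at least [c * s] from all the
    intermediate [z]-rays. This degenerates as [s] tends to 0, but the equality is needed only for
    each [s] separately. *)
Lemma double_integral_rotate p q d0 d1 e c C1 C2 : 0 < c ->
  (forall t, 0 <= t <= 1 -> ray_separated (segment d0 d1 t) e c) ->
  (forall t, 0 <= t <= 1 -> tempered p (segment d0 d1 t) C1) ->
  tempered q e C2 ->
  double_integral p q d0 e = double_integral p q d1 e.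
Proof.
move=> c0 sep tp tq.
have i0 : 0 <= (0 : R) <= 1 by rewrite lexx ler01.
have i1 : 0 <= (1 : R) <= 1 by rewrite lexx ler01.
have s0 := sep 0 i0; have s1 := sep 1 i1; have t0 := tp 0 i0; have t1 := tp 1 i1.
rewrite segment0 in s0 t0; rewrite segment1 in s1 t1.
rewrite (double_integral_swap c0 s0 t0 tq).2 (double_integral_swap c0 s1 t1 tq).2.
apply: eq_cintegral => s sp.
have [b0 hb0] := separatedl c0 (separated_sym s0) sp.
have [b1 hb1] := separatedl c0 (separated_sym s1) sp.
rewrite (ray_integral_kernelr _ b0 hb0 t0) (ray_integral_kernelr _ b1 hb1 t1).
congr (_ * _ * _); apply: (@ray_integral_rotate R p (s%:C * e) d0 d1 (c * s) C1 b0).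
  move=> t r ht r0; have [_ h] := separatedl c0 (separated_sym (sep t ht)) sp.
  exact: h.
by move=> t r ht r0; exact: tp.
Qed.

Lemma ray_integral_kernel_rotate p q d e0 e1 c C2 : 0 < c ->
  (forall t, 0 <= t <= 1 -> ray_separated d (segment e0 e1 t) c) ->
  (forall t, 0 <= t <= 1 -> tempered q (segment e0 e1 t) C2) ->
  forall r, 0 < r ->
  ray_integral e0 (kernel_integrand p q (r%:C * d)) =
  ray_integral e1 (kernel_integrand p q (r%:C * d)).
Proof.
move=> c0 sep tq r rp.
have i0 : 0 <= (0 : R) <= 1 by rewrite lexx ler01.
have i1 : 0 <= (1 : R) <= 1 by rewrite lexx ler01.
have s0 := sep 0 i0; have s1 := sep 1 i1; have t0 := tq 0 i0; have t1 := tq 1 i1.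
rewrite segment0 in s0 t0; rewrite segment1 in s1 t1.
have [b0 hb0] := separatedl c0 s0 rp.
have [b1 hb1] := separatedl c0 s1 rp.
rewrite (ray_integral_kernel _ b0 hb0 t0) (ray_integral_kernel _ b1 hb1 t1).
congr (_ * _); apply: (@ray_integral_rotate R q (r%:C * d) e0 e1 (c * r) C2 b0).
  move=> t s ht s0'; have [_ h] := separatedl c0 (sep t ht) rp.
  exact: h.
by move=> t s ht s0'; exact: tq.
Qed.

End DoubleIntegral.

(** * The rays of the kernels *)

Section Directions.
Context {R : realType}.
Local Notation coefs := (R * R * R * R)%type.
Implicit Types (r s t c C k l x y : R) (d e z w : R[i]) (a p q : coefs)
  (sg xi eta : R).

Definition is_sign x := x ^+ 2 = 1.

Lemma is_sign1 : is_sign 1. Proof. exact: expr1n. Qed.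

Lemma is_signN1 : is_sign (-1). Proof. by rewrite /is_sign sqrrN expr1n. Qed.

Lemma is_signP x : is_sign x -> x = 1 \/ x = -1.
Proof.
by move=> /eqP; rewrite -[1 in X in _ == X](expr1n _ 2) eqf_sqr => /orP[]/eqP; [left|right].
Qed.

(** [Re (z ^+ 4)] is positive between the imaginary axis and slope [1 + sqrt 2], and 3 is the first
    integer slope above that. To the right of the axis [Re (z ^+ 3)] is negative at such slopes. *)
Definition zdir sg l : R[i] := l +i* (sg * (3 * l)).
(** The diagonal of the quadrant with signs [xi] and [eta]. The real part of the fourth power is the
    same in all quadrants, while that of the cube is [- 2 * xi * k ^+ 3], so [xi] decides whether
    the cubic term helps. *)
Definition wdir xi eta k : R[i] := (xi * k) +i* (eta * k).

Lemma segmentE z w t :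
  segment z w t = ((1 - t) * cre z + t * cre w) +i* ((1 - t) * cim z + t * cim w).
Proof.
apply: complexP => /=; first by rewrite /segment creD rmulC /= creD creN; ring.
by rewrite /segment cimD rmulC /= cimD cimN; ring.
Qed.

Lemma creZ r d : cre (r%:C * d) = r * cre d. Proof. by rewrite rmulC. Qed.
Lemma cimZ r d : cim (r%:C * d) = r * cim d. Proof. by rewrite rmulC. Qed.

(** Bounding the modulus below by a real linear functional turns separation of rays into linear
    inequalities. *)
Lemma cnorm_ge_linear z (m n : R) c : `|m| + `|n| <= 3 ->
  3 * c <= m * cre z + n * cim z -> c <= cnorm z.
Proof.
move=> mn h.
have h1 : m * cre z <= `|m| * cnorm z.
  by apply: (le_trans (ler_norm _)); rewrite normrM ler_wpM2l// cre_le_cnorm.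
have h2 : n * cim z <= `|n| * cnorm z.
  by apply: (le_trans (ler_norm _)); rewrite normrM ler_wpM2l// cim_le_cnorm.
have h3 : (`|m| + `|n|) * cnorm z <= 3 * cnorm z by rewrite ler_wpM2r ?cnorm_ge0.
lra.
Qed.

(* The functional [sg * Im - 2 xi * Re] is positive on the sector of the [z]-ray
   and negative on the [w]-ray. *)
Lemma separated_sector sg xi eta x y k c : is_sign sg -> is_sign xi -> is_sign eta ->
  0 <= x -> 3 * x <= y -> 9 * c <= y -> 3 * c <= k -> 0 <= c ->
  ray_separated (x +i* (sg * y)) (wdir xi eta k) c.
Proof.
move=> hs hx he x0 xy cy ck c0 r s r0 s0.
apply: (@cnorm_ge_linear _ (- 2 * xi) sg).
  by case: (is_signP hs) => ->; case: (is_signP hx) => ->;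
    rewrite !normrM !normrN ?normr1 ?normr_nat; lra.
rewrite creD creN cimD cimN !creZ !cimZ /=.
have k0 : 0 <= k by lra.
(* On the [z]-ray the functional is at least [r * (y - 2 * x)], hence at least [r * y / 3]; the
   [w]-ray contributes at least [s * k]. With the factor 3 of [cnorm_ge_linear] this gives the
   constants 9 and 3. *)
have m1 : r * (9 * c) <= r * y by rewrite ler_wpM2l.
have m2 : s * (3 * c) <= s * k by rewrite ler_wpM2l.
have m3 : r * (3 * x) <= r * y by rewrite ler_wpM2l.
have m4 := mulr_ge0 s0 k0; have m5 := mulr_ge0 r0 x0.
by case: (is_signP hs) => ->; case: (is_signP hx) => ->; case: (is_signP he) => ->; lra.
Qed.

Lemma separated_re d e c : c <= cre d -> cre e <= - c -> ray_separated d e c.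
Proof.
move=> hd he r s r0 s0; apply: (@cnorm_ge_linear _ 3 0).
  by rewrite normr0 addr0 normr_nat.
rewrite creD creN !creZ mul0r addr0.
have m1 : r * c <= r * cre d by rewrite ler_wpM2l.
have m2 : s * cre e <= s * - c by rewrite ler_wpM2l.
lra.
Qed.

Lemma cre_wdir4 xi eta k : is_sign xi -> is_sign eta ->
  cre (wdir xi eta k ^+ 4) = - 4 * k ^+ 4.
Proof.
move=> hx he; rewrite cre_exp4 /=.
by case: (is_signP hx) => ->; case: (is_signP he) => ->; ring.
Qed.

Lemma segment_wdir xi eta k l t :
  segment (wdir xi eta k) (wdir xi eta l) t = wdir xi eta ((1 - t) * k + t * l).
Proof. by rewrite segmentE; apply: complexP => /=; ring. Qed.

Lemma convex_ge k l t c : 0 <= t <= 1 -> c <= k -> c <= l -> c <= (1 - t) * k + t * l.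
Proof.
move=> /andP[t0 t1] ck cl.
have h1 : (1 - t) * c <= (1 - t) * k by rewrite ler_wpM2l// subr_ge0.
have h2 : t * c <= t * l by rewrite ler_wpM2l.
lra.
Qed.

(** The parameters [r] and [s] are kept and only the directions are scaled. The form
    [dz dw / (z - w)] is homogeneous of degree one, which leaves a single factor [l]. *)
Lemma double_integral_scale p q d e l :
  0 < l ->
  let sc (a : coefs) := (a.1.1.1 * l ^+ 4, a.1.1.2 * l ^+ 3, a.1.2 * l ^+ 2, a.2 * l) in
  cintegrable (fun r => ray_integral e (kernel_integrand (sc p) (sc q) (r%:C * d)) * d) ->
  double_integral p q (l%:C * d) (l%:C * e) =
  l%:C * double_integral (sc p) (sc q) d e.
Proof.
move=> l0 sc i1.
have lC : l%:C != 0 :> R[i] by rewrite -cnorm_eq0 cnorm_real normr_eq0 gt_eqF.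
have qE a z : quartic a (l%:C * z) = quartic (sc a) z.
  by rewrite /quartic /sc /= !(rmorphXn, rmorphM); ring.
rewrite /double_integral /ray_integral -cintegralZ//.
apply: eq_cintegral => r r0.
have -> : cintegral `]0, +oo[ (fun s =>
    kernel_integrand p q (r%:C * (l%:C * d)) (s%:C * (l%:C * e)) * (l%:C * e)) =
    cintegral `]0, +oo[ (fun s =>
    kernel_integrand (sc p) (sc q) (r%:C * d) (s%:C * e) * e).
  apply: eq_cintegral => s s0.
  rewrite (mulrCA r%:C) (mulrCA s%:C) /kernel_integrand -!qE -mulrBr.
  by rewrite invfM; move: ((r%:C * d - s%:C * e)^-1) => v; field.
by rewrite mulrCA.
Qed.

End Directions.

(** * Rotation and rescaling of the Pearcey rays *)

Section PearceyPair.
Context {R : realType}.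
Local Notation coefs := (R * R * R * R)%type.
Implicit Types (r s t c C k l x y : R) (d e z w : R[i]) (a p q : coefs)
  (sg xi eta : R).

Definition rescale l (a : coefs) : coefs :=
  (a.1.1.1 * l ^+ 4, a.1.1.2 * l ^+ 3, a.1.2 * l ^+ 2, a.2 * l).

Lemma zdirZ sg l : zdir sg l = l%:C * zdir sg 1.
Proof. by rewrite rmulC /zdir /=; congr (_ +i* _); ring. Qed.

Lemma wdirZ xi eta l : wdir xi eta l = l%:C * wdir xi eta 1.
Proof. by rewrite rmulC /wdir /=; congr (_ +i* _); ring. Qed.

Lemma cre_zdir4 sg : is_sign sg -> cre (zdir sg 1 ^+ 4) = 28.
Proof. by move=> /is_signP hs; rewrite cre_exp4 /=; case: hs => ->; ring. Qed.

Lemma cre_zdir3 sg : is_sign sg -> cre (zdir sg 1 ^+ 3) = - 26.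
Proof. by move=> /is_signP hs; rewrite cre_exp3 /=; case: hs => ->; ring. Qed.

Lemma separated_unit sg xi eta : is_sign sg -> is_sign xi -> is_sign eta ->
  ray_separated (zdir sg 1) (wdir xi eta 1) (1 / 3).
Proof. by move=> hs hx he; apply: separated_sector => //; lra. Qed.

Lemma tempered4 a d k : 0 < k -> a.1.1.1 * cre (d ^+ 4) <= - k ->
  exists C, tempered a d C.
Proof.
move=> k0 h; have [C hC] := ray_decay4 a k0 (cnorm_ge0 d).
by exists C => r r0; exact: hC.
Qed.

Lemma tempered_segment4 a d0 d1 k : 0 < k ->
  (forall t, 0 <= t <= 1 -> a.1.1.1 * cre (segment d0 d1 t ^+ 4) <= - k) ->
  exists C, forall t, 0 <= t <= 1 -> tempered a (segment d0 d1 t) C.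
Proof.
move=> k0 h.
have B0 : 0 <= cnorm d0 + cnorm d1 by rewrite addr_ge0 ?cnorm_ge0.
have [C hC] := ray_decay4 a k0 B0.
by exists C => t ht r r0; apply: hC => //; [exact: segment_bound|exact: h].
Qed.

Lemma cintegrable_unit_pair sg xi eta p q : is_sign sg -> is_sign xi -> is_sign eta ->
  p.1.1.1 < 0 -> 0 < q.1.1.1 ->
  cintegrable (fun r => ray_integral (wdir xi eta 1)
    (kernel_integrand p q (r%:C * zdir sg 1)) * zdir sg 1).
Proof.
move=> hs hx he p4 q4.
have [C1 tp] : exists C, tempered p (zdir sg 1) C.
  apply: (@tempered4 _ _ (- (p.1.1.1 * 28))); last by rewrite cre_zdir4//; lra.
  by lra.
have [C2 tq] : exists C, tempered q (wdir xi eta 1) C.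
  apply: (@tempered4 _ _ (q.1.1.1 * 4)); last by rewrite cre_wdir4//; lra.
  by lra.
have c0 : 0 < (1 / 3 : R) by lra.
exact: (double_integral_swap c0 (separated_unit hs hx he) tp tq).1.
Qed.

(** The [z]-ray goes to [zdir sg l] for the given [w]-ray, then the [w]-ray is stretched from length
    factor [k] to [l]; both directions are now multiples by [l] of the unit ones and the scaling
    applies. *)
Lemma pearcey_pair p q sg xi eta k l : is_sign sg -> is_sign xi -> is_sign eta ->
  0 < k -> 0 < l -> p.1.1.1 < 0 -> 0 < q.1.1.1 ->
  cintegrable (fun r => ray_integral (wdir xi eta k)
    (kernel_integrand p q (r%:C * (0 +i* sg))) * (0 +i* sg)) /\
  double_integral p q (0 +i* sg) (wdir xi eta k) =
  l%:C * double_integral (rescale l p) (rescale l q) (zdir sg 1) (wdir xi eta 1).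
Proof.
move=> hs hx he k0 l0 p4 q4.
(* Along the deformations [m] bounds the height of the [z]-direction from below and [n] the size of
   the [w]-direction; [c] then meets the requirements [9 * c <= y] and [3 * c <= k] of
   [separated_sector]. *)
pose m := Num.min 1 (3 * l).
have m0 : 0 < m by rewrite lt_min ltr01 mulr_gt0.
have [m1 ml] : m <= 1 /\ m <= 3 * l by rewrite !ge_min !lexx orbT.
pose n := Num.min k l.
have n0 : 0 < n by rewrite lt_min k0.
have [nk nl] : n <= k /\ n <= l by rewrite !ge_min !lexx orbT.
pose c := Num.min (m / 9) (n / 3).
have c0 : 0 < c by rewrite lt_min; apply/andP; split; lra.
have [cm cn] : c <= m / 9 /\ c <= n / 3 by rewrite !ge_min !lexx orbT.
have sE t : segment (0 +i* sg) (zdir sg l) t =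
    (t * l) +i* (sg * ((1 - t) * 1 + t * (3 * l))).
  by rewrite segmentE; apply: complexP => /=; ring.
have sep1 t : 0 <= t <= 1 ->
    ray_separated (segment (0 +i* sg) (zdir sg l) t) (wdir xi eta k) c.
  move=> ht; rewrite sE; have hy := convex_ge ht m1 ml; move/andP: ht => [t0 t1].
  have tl : 0 <= t * l by rewrite mulr_ge0// ltW.
  have hxy : 3 * (t * l) <= (1 - t) * 1 + t * (3 * l) by lra.
  move: ((1 - t) * 1 + t * (3 * l)) hy hxy => y hy hxy.
  by apply: separated_sector => //; lra.
have [C1 tp1] : exists C, forall t, 0 <= t <= 1 ->
    tempered p (segment (0 +i* sg) (zdir sg l) t) C.
  apply: (@tempered_segment4 _ _ _ (- p.1.1.1 * (m ^+ 4 / 3))).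
    by rewrite mulr_gt0 ?oppr_gt0// divr_gt0// exprn_gt0.
  move=> t ht; rewrite sE; have hy := convex_ge ht m1 ml; move/andP: ht => [t0 t1].
  have tl : 0 <= t * l by rewrite mulr_ge0// ltW.
  have hxy : 3 * (t * l) <= (1 - t) * 1 + t * (3 * l) by lra.
  move: ((1 - t) * 1 + t * (3 * l)) hy hxy => y hy hxy.
  move: (t * l) tl hxy => x x0 hxy.
  rewrite mulNr opprK ler_nM2l// cre_exp4 /=.
  have -> : x ^+ 4 - 6 * x ^+ 2 * (sg * y) ^+ 2 + (sg * y) ^+ 4 =
      x ^+ 4 - 6 * x ^+ 2 * y ^+ 2 + y ^+ 4.
    by case: (is_signP hs) => ->; ring.
  have y0 : 0 <= y by lra.
  have hm : m ^+ 4 <= y ^+ 4 by rewrite lerXn2r ?nnegrE// ltW.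
  (* Slope at least 3 gives [6 * x ^+ 2 * y ^+ 2 <= 2 / 3 * y ^+ 4], so a third of [y ^+ 4]
     survives; hence the constant [m ^+ 4 / 3]. *)
  have h9 : (3 * x) ^+ 2 <= y ^+ 2 by rewrite lerXn2r ?nnegrE// mulr_ge0.
  have h2 : (3 * x) ^+ 2 * y ^+ 2 <= y ^+ 2 * y ^+ 2 by rewrite ler_wpM2r ?sqr_ge0.
  have x4 : 0 <= x ^+ 4 by rewrite exprn_ge0.
  have : y ^+ 2 * y ^+ 2 = y ^+ 4 by ring.
  lra.
have [C2 tq1] : exists C, tempered q (wdir xi eta k) C.
  apply: (@tempered4 _ _ (q.1.1.1 * (4 * k ^+ 4))).
    by rewrite !mulr_gt0 ?exprn_gt0.
  by rewrite cre_wdir4//; lra.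
have [C3 tq2] : exists C, forall t, 0 <= t <= 1 ->
    tempered q (segment (wdir xi eta k) (wdir xi eta l) t) C.
  apply: (@tempered_segment4 _ _ _ (q.1.1.1 * (4 * n ^+ 4))).
    by rewrite !mulr_gt0 ?exprn_gt0.
  move=> t ht; rewrite segment_wdir cre_wdir4// -mulrN ler_pM2l//.
  have := convex_ge ht nk nl; move: (_ + t * l) => y hy.
  have hm : n ^+ 4 <= y ^+ 4 by rewrite lerXn2r ?nnegrE//; lra.
  lra.
have sep2 t : 0 <= t <= 1 ->
    ray_separated (zdir sg l) (segment (wdir xi eta k) (wdir xi eta l) t) c.
  move=> ht; rewrite segment_wdir; have := convex_ge ht nk nl.
  move: (_ + t * l) => y hy; apply: separated_sector => //; lra.
have i0 : 0 <= (0 : R) <= 1 by rewrite lexx ler01.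
have sep0 := sep1 0 i0; have tp0 := tp1 0 i0; rewrite segment0 in sep0 tp0.
split; first exact: (double_integral_swap c0 sep0 tp0 tq1).1.
rewrite (double_integral_rotate c0 sep1 tp1 tq1).
have -> : double_integral p q (zdir sg l) (wdir xi eta k) =
    double_integral p q (zdir sg l) (wdir xi eta l).
  apply: eq_cintegral => r r0.
  by rewrite (ray_integral_kernel_rotate p c0 sep2 tq2 r0).
rewrite zdirZ (wdirZ xi eta l); apply: double_integral_scale => //.
apply: cintegrable_unit_pair => //=.
  by rewrite nmulr_rlt0 ?exprn_gt0.
by rewrite mulr_gt0 ?exprn_gt0.
Qed.

End PearceyPair.

(** * Rotation of the Airy rays *)

Section AiryPair.
Context {R : realType}.
Implicit Types (r s t c C k l x y : R) (d e z w : R[i]) (sg xi eta : R).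

Lemma tempered_segment3 (c4 c3 c2 c1 : R) d0 d1 k : 0 < k ->
  (forall t, 0 <= t <= 1 -> c4 * cre (segment d0 d1 t ^+ 4) <= 0) ->
  (forall t, 0 <= t <= 1 -> c3 * cre (segment d0 d1 t ^+ 3) <= - k) ->
  exists C, forall t, 0 <= t <= 1 ->
    tempered (c4, c3, c2, c1) (segment d0 d1 t) C.
Proof.
move=> k0 h4 h3.
have B0 : 0 <= cnorm d0 + cnorm d1 by rewrite addr_ge0 ?cnorm_ge0.
have [C hC] := ray_decay3 c2 c1 k0 B0.
exists C => t ht r r0; apply: hC => //; first exact: segment_bound.
  exact: h4.
exact: h3.
Qed.

(** [h] stands for [sin (pi / 3)]. Without a quartic term all decay is cubic. Throughout both
    rotations the [z]-direction has real part at least 1/2 and the [w]-direction at most -1/2, which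
    separates the rays. *)
Lemma airy_pair (p3 p2 p1 q3 q2 q1 h sg eta : R) : is_sign sg -> is_sign eta ->
  0 < h -> h ^+ 2 = 3 / 4 -> 0 < p3 -> q3 < 0 ->
  let p := (0, p3, p2, p1) in let q := (0, q3, q2, q1) in
  let d := 2^-1 +i* (sg * h) in let e := (- 2^-1) +i* (eta * h) in
  cintegrable (fun r => ray_integral e (kernel_integrand p q (r%:C * d)) * d) /\
  double_integral p q d e = double_integral p q (zdir sg 1) (wdir (-1) eta 1).
Proof.
move=> hs he h0 h2 p30 q30 p q d e.
have hN1 := @is_signN1 R.
have h1 : 1 / 2 <= h by nra.
have hle : h <= 1 by nra.
have c0 : 0 < (1 / 2 : R) by lra.
have sE1 t : segment d (zdir sg 1) t =
    ((1 - t) / 2 + t) +i* (sg * ((1 - t) * h + 3 * t)).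
  by rewrite segmentE; apply: complexP => /=; field.
have sE2 t : segment e (wdir (-1) eta 1) t =
    (- ((1 - t) / 2 + t)) +i* (eta * ((1 - t) * h + t)).
  by rewrite segmentE; apply: complexP => /=; field.
have sep1 t : 0 <= t <= 1 -> ray_separated (segment d (zdir sg 1) t) e (1 / 2).
  by move=> /andP[t0 t1]; apply: separated_re; rewrite ?sE1 /=; lra.
have sep2 t : 0 <= t <= 1 ->
    ray_separated (zdir sg 1) (segment e (wdir (-1) eta 1) t) (1 / 2).
  by move=> /andP[t0 t1]; apply: separated_re; rewrite ?sE2 /=; lra.
have [C1 tp] : exists C, forall t, 0 <= t <= 1 -> tempered p (segment d (zdir sg 1) t) C.
  apply: (@tempered_segment3 _ _ _ _ _ _ p3) => // t /andP[t0 t1].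
    by rewrite mul0r.
  rewrite sE1 cre_exp3 /= -[leRHS]mulrN1 ler_pM2l//.
  (* The slope stays at least [2 * h], whose square is 3. Hence
     [x ^+ 3 - 3 * x * y ^+ 2 <= - 8 * x ^+ 3], which is at most -1 as [x] is at least 1/2. *)
  have : 0 <= t * (3 - 2 * h) by rewrite mulr_ge0//; lra.
  move=> tt; have xy : 2 * h * ((1 - t) / 2 + t) <= (1 - t) * h + 3 * t by lra.
  have x2 : 1 / 2 <= (1 - t) / 2 + t by lra.
  move: ((1 - t) / 2 + t) ((1 - t) * h + 3 * t) x2 xy => x y x2 xy.
  have y2 : (2 * h * x) ^+ 2 <= y ^+ 2.
    have hx : 0 <= 2 * h * x by rewrite !mulr_ge0//; lra.
    by rewrite lerXn2r ?nnegrE//; lra.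
  have y3 : x * (3 * x ^+ 2) <= x * y ^+ 2.
    rewrite ler_wpM2l//; first by lra.
    by rewrite !exprMn h2 in y2; lra.
  have x3 : (1 / 2) ^+ 3 <= x ^+ 3 by rewrite lerXn2r ?nnegrE//; lra.
  have -> : x ^+ 3 - 3 * x * (sg * y) ^+ 2 = x ^+ 3 - 3 * (x * y ^+ 2).
    by case: (is_signP hs) => ->; ring.
  have : x * (3 * x ^+ 2) = 3 * x ^+ 3 by ring.
  lra.
have [C2 tq] : exists C, forall t, 0 <= t <= 1 ->
    tempered q (segment e (wdir (-1) eta 1) t) C.
  apply: (@tempered_segment3 _ _ _ _ _ _ (- q3 / 4)) => [|t|t /andP[t0 t1]].
  - by rewrite divr_gt0// oppr_gt0.
  - by rewrite mul0r.
  rewrite sE2 cre_exp3 /= mulNr opprK ler_nM2l//.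
  (* Here the slope is at least 1 in absolute value, so the real part of the cube is at least
     [2 * x ^+ 3], hence at least 1/4. *)
  have tt : 0 <= (1 - t) * (h - 1 / 2) by rewrite mulr_ge0//; lra.
  have xy : (1 - t) / 2 + t <= (1 - t) * h + t by lra.
  have x2 : 1 / 2 <= (1 - t) / 2 + t by lra.
  move: ((1 - t) / 2 + t) ((1 - t) * h + t) x2 xy => x y x2 xy.
  have y2 : x ^+ 2 <= y ^+ 2 by rewrite lerXn2r ?nnegrE//; lra.
  have y3 : x * x ^+ 2 <= x * y ^+ 2 by rewrite ler_wpM2l//; lra.
  have x3 : (1 / 2) ^+ 3 <= x ^+ 3 by rewrite lerXn2r ?nnegrE//; lra.
  have -> : (- x) ^+ 3 - 3 * (- x) * (eta * y) ^+ 2 = - x ^+ 3 + 3 * (x * y ^+ 2).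
    by case: (is_signP he) => ->; ring.
  have : x * x ^+ 2 = x ^+ 3 by ring.
  lra.
have i0 : 0 <= (0 : R) <= 1 by rewrite lexx ler01.
have i1 : 0 <= (1 : R) <= 1 by rewrite lexx ler01.
have sep0 := sep1 0 i0; have tp0 := tp 0 i0; have tq0 := tq 0 i0.
rewrite segment0 in sep0 tp0; rewrite segment0 in tq0.
split; first exact: (double_integral_swap c0 sep0 tp0 tq0).1.
rewrite (double_integral_rotate c0 sep1 tp tq0).
apply: eq_cintegral => r r0.
by rewrite (ray_integral_kernel_rotate p c0 sep2 tq r0).
Qed.

End AiryPair.

(** * The right rays and the saddle point *)

Section RightContour.
Context {R : realType}.
Implicit Types (r s t c C k l x y : R) (d e z w : R[i]) (sg xi eta tau u v eps : R).

(* The exponents after the substitution [z := a^(-1/3) z], with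
   [eps = a^(-4/3)]. *)
Definition pz eps tau v : R * R * R * R := (- (1 / 4) * eps, 1 / 3, - tau, - v).
Definition qw eps tau u : R * R * R * R := (1 / 4 * eps, - (1 / 3), tau, u).

Lemma cre_quartic_shift eps tau u y s eta : is_sign eta ->
  cre (quartic (qw eps tau u) (y%:C + s%:C * wdir 1 eta 1)) =
  eps / 4 * (- 4 * s ^+ 4 - 8 * (y * s ^+ 3) + 4 * (y ^+ 3 * s) + y ^+ 4)
  - (y ^+ 3 + 3 * (y ^+ 2 * s) - 2 * s ^+ 3) / 3
  + tau * (y ^+ 2 + 2 * (y * s)) + u * (y + s).
Proof.
move=> he; rewrite cre_quartic cre_exp2 cre_exp3 cre_exp4 creD cimD rmulC /=.
by case: (is_signP he) => ->; field.
Qed.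

(** At fixed [eps] the term [- eps * s ^+ 4] beats the growing [2 / 3 * s ^+ 3] at every stage of
    the translation. [C] depends on [eps]: it only justifies the translation and does not enter the
    final estimate. *)
Lemma shift_tempered eps tau u x : 0 < eps -> 0 <= x ->
  exists C, forall eta y s, is_sign eta -> 0 <= y <= x -> 0 <= s ->
  cre (quartic (qw eps tau u) (y%:C + s%:C * wdir 1 eta 1)) <= C - 5 * s.
Proof.
move=> e0 x0.
have a3 : 0 <= 2 / 3 :> R by lra.
have a1 : 0 <= eps * x ^+ 3 + 2 * (`|tau| * x) + `|u| + 5.
  by rewrite !addr_ge0 ?mulr_ge0 ?exprn_ge0// ltW.
have [C hC] := quartic_decay e0 a3 (lexx 0) a1.
exists (C + (eps * x ^+ 4 + `|tau| * x ^+ 2 + `|u| * x)) => eta y s he /andP[y0 yx] s0.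
rewrite cre_quartic_shift//; have := hC s s0.
have y3 : y ^+ 3 <= x ^+ 3 by rewrite lerXn2r ?nnegrE.
have y4 : y ^+ 4 <= x ^+ 4 by rewrite lerXn2r ?nnegrE.
have y2 : y ^+ 2 <= x ^+ 2 by rewrite lerXn2r ?nnegrE.
have m1 : 0 <= eps * (y * s ^+ 3) by rewrite mulr_ge0 ?(ltW e0)// mulr_ge0 ?exprn_ge0.
have m2 : eps * (y ^+ 3 * s) <= eps * (x ^+ 3 * s).
  by rewrite ler_wpM2l ?(ltW e0)// ler_wpM2r.
have m3 : eps * y ^+ 4 <= eps * x ^+ 4 by rewrite ler_wpM2l ?(ltW e0).
have m3' : 0 <= eps * x ^+ 4 by rewrite mulr_ge0 ?exprn_ge0// ltW.
have m4 : 0 <= y ^+ 3 by rewrite exprn_ge0.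
have m5 : 0 <= y ^+ 2 * s by rewrite mulr_ge0 ?exprn_ge0.
have m6 : tau * y ^+ 2 <= `|tau| * x ^+ 2.
  apply: (@le_trans _ _ (`|tau| * y ^+ 2)); last by rewrite ler_wpM2l.
  by rewrite ler_wpM2r ?exprn_ge0// ler_norm.
have m7 : tau * (y * s) <= `|tau| * (x * s).
  apply: (@le_trans _ _ (`|tau| * (y * s))).
    by rewrite ler_wpM2r ?mulr_ge0// ler_norm.
  by rewrite ler_wpM2l// ler_wpM2r.
have m8 : u * y <= `|u| * x.
  apply: (@le_trans _ _ (`|u| * y)); first by rewrite ler_wpM2r// ler_norm.
  by rewrite ler_wpM2l.
have m9 : u * s <= `|u| * s by rewrite ler_wpM2r// ler_norm.
lra.
Qed.

(* [eps^-1] is the saddle point of [eps / 4 * w ^+ 4 - w ^+ 3 / 3], where the value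
   is [- eps^-1 ^+ 3 / 12]. *)
Lemma saddle_tempered tau u : exists C, forall eps eta s, is_sign eta ->
  0 < eps -> 0 <= s ->
  cre (quartic (qw eps tau u) (eps^-1%:C + s%:C * wdir 1 eta 1)) <=
  C - eps^-1 - 5 * s.
Proof.
(* At the saddle point the terms linear in [s] from the quartic and the cubic cancel. What remains
   is [- 2 + 2 / 3 = - 4 / 3] times [s ^+ 3] and [1 / 4 - 1 / 3 = - 1 / 12] times [eps^-1 ^+ 3]. In
   the linear coefficients below, 5 pays for [5 * s] and 1 for [eps^-1]. *)
have k1 : 0 < 4 / 3 :> R by lra.
have k2 : 0 < 1 / 12 :> R by lra.
have a1 : 0 <= `|u| + 5 by rewrite addr_ge0.
have a2 : 0 <= `|u| + 1 by rewrite addr_ge0.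
have a3 : 0 <= 2 * `|tau| by rewrite mulr_ge0.
have [Ca hCa] := cubic_decay k1 (normr_ge0 tau) a1.
have [Cb hCb] := cubic_decay k2 a3 a2.
exists (Ca + Cb) => eps eta s he e0 s0; rewrite cre_quartic_shift//.
have x0 : 0 <= eps^-1 by rewrite invr_ge0 ltW.
have := hCa s s0; have := hCb _ x0.
have -> : eps / 4 * (- 4 * s ^+ 4 - 8 * (eps^-1 * s ^+ 3) +
    4 * (eps^-1 ^+ 3 * s) + eps^-1 ^+ 4) =
    - (eps * s ^+ 4) - 2 * s ^+ 3 + eps^-1 ^+ 2 * s + eps^-1 ^+ 3 / 4.
  by field; rewrite gt_eqF.
have es : 0 <= eps * s ^+ 4 by rewrite mulr_ge0 ?exprn_ge0// ltW.
move: (eps^-1) x0 => x x0.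
have m6 : tau * x ^+ 2 <= `|tau| * x ^+ 2 by rewrite ler_wpM2r ?exprn_ge0// ler_norm.
have m7 : tau * (2 * (x * s)) <= `|tau| * (x ^+ 2 + s ^+ 2).
  apply: (@le_trans _ _ (`|tau| * (2 * (x * s)))).
    by rewrite ler_wpM2r ?mulr_ge0// ler_norm.
  by rewrite ler_wpM2l//; have := sqr_ge0 (x - s); rewrite sqrrB -mulr_natl; lra.
have m8 : u * x <= `|u| * x by rewrite ler_wpM2r// ler_norm.
have m9 : u * s <= `|u| * s by rewrite ler_wpM2r// ler_norm.
lra.
Qed.

(** Used twice: [r / 3] keeps the pole off the rays during the translation, and once [y] is at least
    1 the term in [y] keeps it off uniformly in [r], so that the translated integrals have no
    singularity left. *)
Lemma shift_separated sg eta y r s : is_sign sg -> is_sign eta ->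
  0 <= y -> 0 <= r -> 0 <= s ->
  (r + 2 * y) / 3 <= cnorm (y%:C + s%:C * wdir 1 eta 1 - r%:C * zdir sg 1).
Proof.
move=> hs he y0 r0 s0; rewrite -opprB cnormN.
apply: (@cnorm_ge_linear _ _ (- 2) sg).
  by case: (is_signP hs) => ->; rewrite ?normrN ?normr1 ?normr_nat; lra.
rewrite !(creD, creN, cimD, cimN, creZ, cimZ) /=.
by case: (is_signP hs) => ->; case: (is_signP he) => ->; lra.
Qed.

(** Only the difference can be translated, as the boundary terms cancel in it. A bound linear in
    [eps] suffices for the limit, and it follows from the weakened saddle estimate with
    [- eps^-1]. *)
Lemma right_contour_bound sg tau1 tau2 u v : is_sign sg ->
  exists K, forall eps, 0 < eps <= 1 ->
  cnorm (double_integral (pz eps tau2 v) (qw eps tau1 u) (zdir sg 1) (wdir 1 (-1) 1)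
    - double_integral (pz eps tau2 v) (qw eps tau1 u) (zdir sg 1) (wdir 1 1 1))
  <= K * eps.
Proof.
move=> hs.
have h1 := @is_sign1 R.
have hN1 := @is_signN1 R.
have k1 : 0 < (1 : R) by [].
have [C1 hC1] := ray_decay3 (- tau2) (- v) k1 (cnorm_ge0 (zdir sg 1)).
have [C2 hC2] := saddle_tempered tau1 u.
pose E := \int[lebesgue_measure]_(r in `]0, +oo[) expR (- r) : R.
have E0 : 0 <= E by apply: Rintegral_ge0 => r _; exact: expR_ge0.
pose N := cnorm (wdir 1 (-1) 1 : R[i]) + cnorm (wdir 1 1 1 : R[i]).
have N0 : 0 <= N by rewrite addr_ge0 ?cnorm_ge0.
pose M eps := expR C1 * (4 * (expR (C2 - eps^-1) / (1 / 3) * N * E)) * cnorm (zdir sg 1).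
exists (2 * (expR C1 * (4 * (expR C2 / (1 / 3) * N * E)) * cnorm (zdir sg 1) * E)).
move=> eps /andP[e0 e1].
have x1 : 1 <= eps^-1 by rewrite invf_ge1.
have x0 : 0 <= eps^-1 by lra.
set p := pz eps tau2 v; set q := qw eps tau1 u.
have tp : tempered p (zdir sg 1) C1.
  move=> r r0; apply: hC1 => //; first by rewrite cre_zdir4//; lra.
  by rewrite cre_zdir3//; lra.
have hd d : d = wdir 1 (-1) 1 \/ d = wdir 1 1 1 ->
    exists2 eta, is_sign eta & d = wdir 1 eta 1.
  by case=> ->; [exists (-1)|exists 1].
have [C3 hC3] := shift_tempered tau1 u e0 x0.
have tq eta : is_sign eta -> tempered q (wdir 1 eta 1) C3.
  move=> he r r0; have := hC3 eta 0 r he _ r0; rewrite add0r; apply.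
  by rewrite lexx.
have p4 : p.1.1.1 < 0 by rewrite /= mulNr oppr_lt0 mulr_gt0//; lra.
have q4 : 0 < q.1.1.1 by rewrite /= mulr_gt0//; lra.
have i1 := cintegrable_unit_pair hs h1 hN1 p4 q4.
have i2 := cintegrable_unit_pair hs h1 h1 p4 q4.
have c0 : 0 < (1 / 3 : R) by lra.
have saddle eta : is_sign eta -> forall r, 0 < r ->
    cnorm (ray_from eps^-1%:C (wdir 1 eta 1) (cauchy_exp q (r%:C * zdir sg 1))) <=
    2 * (expR (C2 - eps^-1) / (1 / 3) * N * E).
  move=> he r r0.
  have [||hb iF] := @cintegrable_cauchy _ q (r%:C * zdir sg 1) eps^-1 (wdir 1 eta 1)
    (1 / 3) (C2 - eps^-1) c0.
  - move=> s s0; apply: le_trans (shift_separated hs he x0 (ltW r0) s0); lra.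
  - by move=> s s0; exact: hC2.
  pose K := expR (C2 - eps^-1) / (1 / 3) * cnorm (wdir 1 eta 1 : R[i]).
  have iK := rintegrableZ K (@rintegrable_expN R).
  apply: (le_trans (cnorm_cintegral iF iK hb)).
  rewrite (RintegralZl _ (@measurable_pos R) (@rintegrable_expN R)).
  rewrite ler_wpM2l// -/E ler_wpM2r// /K ler_wpM2l//.
  by rewrite /N; case: (is_signP he) => ->; rewrite ?lerDl ?lerDr cnorm_ge0.
have key r : 0 < r -> cnorm (ray_integral (wdir 1 (-1) 1) (kernel_integrand p q (r%:C * zdir sg 1)) * zdir sg 1
     + - (ray_integral (wdir 1 1 1) (kernel_integrand p q (r%:C * zdir sg 1)) * zdir sg 1))
     <= M eps * expR (- r).
  move=> r0.
  have [b0 hb1] := separatedl c0 (separated_unit hs h1 hN1) r0.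
  have [_ hb2] := separatedl c0 (separated_unit hs h1 h1) r0.
  rewrite (ray_integral_kernel p b0 hb1 (tq _ hN1)).
  rewrite (ray_integral_kernel p b0 hb2 (tq _ h1)).
  rewrite -mulrBl -mulrBr cnormM cnormM cnormN cnorm_exp.
  have r3 : 0 < r / 3 by lra.
  rewrite (@ray_integral_shift R q (r%:C * zdir sg 1) _ _ eps^-1 (r / 3) C3)//; last 2 first.
  - move=> t s d /andP[t0 t1] s0 /hd[eta he ->].
    apply: le_trans (shift_separated hs he (mulr_ge0 t0 x0) (ltW r0) s0).
    by have := mulr_ge0 t0 x0; lra.
  - move=> t s d /andP[t0 t1] s0 /hd[eta he ->].
    by apply: hC3 => //; rewrite mulr_ge0//= ler_piMl.
  have hM : expR (cre (quartic p (r%:C * zdir sg 1))) <= expR C1 * expR (- r).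
    rewrite -expRD ler_expR; have := tp r (ltW r0); lra.
  have -> : M eps * expR (- r) = expR C1 * expR (- r) *
      (4 * (expR (C2 - eps^-1) / (1 / 3) * N * E)) * cnorm (zdir sg 1).
    by rewrite /M; ring.
  rewrite ler_wpM2r ?cnorm_ge0//.
  apply: ler_pM; rewrite ?expR_ge0 ?cnorm_ge0//.
  apply: (le_trans (cnormD _ _)); rewrite cnormN.
  have := saddle _ hN1 r r0; have := saddle _ h1 r r0; lra.
have -> : double_integral p q (zdir sg 1) (wdir 1 (-1) 1) -
    double_integral p q (zdir sg 1) (wdir 1 1 1) =
  cintegral `]0, +oo[ (fun r =>
     ray_integral (wdir 1 (-1) 1) (kernel_integrand p q (r%:C * zdir sg 1)) * zdir sg 1
     + - (ray_integral (wdir 1 1 1) (kernel_integrand p q (r%:C * zdir sg 1)) * zdir sg 1)).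
  by rewrite cintegralD// ?cintegralN//; exact: cintegrableN.
have iM := rintegrableZ (M eps) (@rintegrable_expN R).
apply: (le_trans (cnorm_cintegral (cintegrableD i1 (cintegrableN i2)) iM key)).
rewrite (RintegralZl _ (@measurable_pos R) (@rintegrable_expN R)).
rewrite -mulrA ler_wpM2l// -/E [leRHS]mulrAC ler_wpM2r//.
rewrite /M expRD expRN.
(* From [1 + x <= expR x] at [x = eps^-1]. *)
have ee : (expR eps^-1)^-1 <= eps.
  rewrite -[leRHS]invrK lef_pV2 ?posrE ?expR_gt0 ?invr_gt0//.
  by have := expR_ge1Dx eps^-1; lra.
pose Q := expR C1 * (4 * (expR C2 / (1 / 3) * N * E)) * cnorm (zdir sg 1).
have Q0 : 0 <= Q.
  by rewrite /Q !mulr_ge0 ?expR_ge0 ?cnorm_ge0//; lra.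
have -> : expR C1 * (4 * (expR C2 * (expR eps^-1)^-1 / (1 / 3) * N * E)) * cnorm (zdir sg 1) =
   Q * (expR eps^-1)^-1 by rewrite /Q; ring.
by rewrite ler_wpM2l.
Qed.

End RightContour.

(** * The limit *)

Section Limit.
Context {R : realType}.
Local Notation T := (measurableTypeR R).
Local Notation mu := (@lebesgue_measure R).
Local Notation pos := (`]0, +oo[%classic : set T).
Implicit Types (r s t c C k l x y : R) (d e z w : R[i]) (sg xi eta tau u v eps : R).

Lemma ccvg_cst z : ccvg (fun=> z) z.
Proof. by split; exact: cvg_cst. Qed.

Lemma ccvgD (f g : nat -> R[i]) z w : ccvg f z -> ccvg g w ->
  ccvg (fun n => f n + g n) (z + w).
Proof.
move=> [f1 f2] [g1 g2]; split.
  by under eq_fun do rewrite creD; rewrite creD; exact: cvgD.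
by under eq_fun do rewrite cimD; rewrite cimD; exact: cvgD.
Qed.

Lemma ccvgM (f g : nat -> R[i]) z w : ccvg f z -> ccvg g w ->
  ccvg (fun n => f n * g n) (z * w).
Proof.
move=> [f1 f2] [g1 g2]; split.
  by under eq_fun do rewrite creM; rewrite creM; apply: cvgB; exact: cvgM.
by under eq_fun do rewrite cimM; rewrite cimM; apply: cvgD; exact: cvgM.
Qed.

Lemma ccvgN (f : nat -> R[i]) z : ccvg f z -> ccvg (fun n => - f n) (- z).
Proof.
move=> [f1 f2]; split.
  by under eq_fun do rewrite creN; rewrite creN; exact: cvgN.
by under eq_fun do rewrite cimN; rewrite cimN; exact: cvgN.
Qed.

Lemma ccvg_real (f : nat -> R) x : f n @[n --> \oo] --> x ->
  ccvg (fun n => (f n)%:C) x%:C.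
Proof. by move=> fx; split => //=; exact: cvg_cst. Qed.

Lemma ccvg_exp (f : nat -> R[i]) z : ccvg f z ->
  ccvg (fun n => cexp (f n)) (cexp z).
Proof.
move=> [f1 f2].
have e : expR (cre (f n)) @[n --> \oo] --> expR (cre z).
  exact: (continuous_cvg _ (@continuous_expR R _) f1).
split.
  under eq_fun do rewrite creexp; rewrite creexp; apply: cvgM => //.
  exact: (continuous_cvg _ (@continuous_cos R _) f2).
under eq_fun do rewrite cimexp; rewrite cimexp; apply: cvgM => //.
exact: (continuous_cvg _ (@continuous_sin R _) f2).
Qed.

Lemma ccvg0_cnorm (f : nat -> R[i]) (g : nat -> R) :
  (forall n, cnorm (f n) <= g n) -> g n @[n --> \oo] --> 0 -> ccvg f 0.
Proof.
move=> fg g0; split; apply: norm_cvg0.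
  apply: (squeeze_cvgr _ (cvg_cst 0) g0); apply: nearW => n.
  by rewrite normr_ge0 /= (le_trans (cre_le_cnorm _) (fg n)).
apply: (squeeze_cvgr _ (cvg_cst 0) g0); apply: nearW => n.
by rewrite normr_ge0 /= (le_trans (cim_le_cnorm _) (fg n)).
Qed.

Lemma ccvg_quartic (c4 : nat -> R) (x4 c3 c2 c1 : R) z :
  c4 n @[n --> \oo] --> x4 ->
  ccvg (fun n => quartic (c4 n, c3, c2, c1) z) (quartic (x4, c3, c2, c1) z).
Proof.
move=> h; apply: ccvgD; last exact: ccvg_cst.
apply: ccvgD; last exact: ccvg_cst; apply: ccvgD; last exact: ccvg_cst.
by apply: ccvgM; [exact: ccvg_real|exact: ccvg_cst].
Qed.

(** Dominated convergence is applied to the inner and then to the outer integral. The constants [C1]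
    and [C2] come from the cubic terms and do not depend on [n]; integrating the inner majorant
    yields the outer one. *)
Lemma left_contour_cvg sg eta tau1 tau2 u v (eps : nat -> R) :
  is_sign sg -> is_sign eta -> (forall n, 0 < eps n) -> eps n @[n --> \oo] --> 0 ->
  ccvg (fun n => double_integral (pz (eps n) tau2 v) (qw (eps n) tau1 u)
                   (zdir sg 1) (wdir (-1) eta 1))
    (double_integral (0, 1 / 3, - tau2, - v) (0, - (1 / 3), tau1, u)
      (zdir sg 1) (wdir (-1) eta 1)).
Proof.
move=> hs he e0 elim.
have hN1 := @is_signN1 R.
set d := zdir sg 1; set e := wdir (-1) eta 1.
(* The cubic terms contribute [- 26 / 3] along [d] and [- 2 / 3] along [e], below -1 and -1/2. *)
have k1 : 0 < (1 : R) by []. have k2 : 0 < (1 / 2 : R) by lra.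
have [C1 hC1] := ray_decay3 (- tau2) (- v) k1 (cnorm_ge0 d).
have [C2 hC2] := ray_decay3 tau1 u k2 (cnorm_ge0 e).
have tp n : tempered (pz (eps n) tau2 v) d C1.
  move=> r r0; apply: hC1 => //; first by rewrite cre_zdir4//; have := e0 n; lra.
  by rewrite cre_zdir3//; lra.
have e3 : cre (e ^+ 3) = 2.
  by rewrite cre_exp3 /=; case: (is_signP he) => ->; ring.
have tq n : tempered (qw (eps n) tau1 u) e C2.
  move=> r r0; apply: hC2 => //; first by rewrite cre_wdir4//; have := e0 n; lra.
  by rewrite e3; lra.
have sep := separated_unit hs hN1 he.
have c0 : 0 < (1 / 3 : R) by lra.
pose K := expR (C1 + C2) / (1 / 3).
have K0 : 0 <= K by rewrite divr_ge0 ?expR_ge0//; lra.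
have bK n r s : 0 < r -> 0 < s ->
    cnorm (kernel_integrand (pz (eps n) tau2 v) (qw (eps n) tau1 u)
      (r%:C * d) (s%:C * e)) <= K * halfpow r * halfpow s.
  move=> r0 s0; apply: kernel_integrand_le => //; first exact: sep (ltW r0) (ltW s0).
    by apply: tp; exact: ltW.
  by apply: tq; exact: ltW.
have elim1 : - (1 / 4) * eps n @[n --> \oo] --> 0.
  by rewrite -[X in _ --> X](mulr0 (- (1 / 4))); apply: cvgM => //; exact: cvg_cst.
have elim2 : 1 / 4 * eps n @[n --> \oo] --> 0.
  by rewrite -[X in _ --> X](mulr0 (1 / 4)); apply: cvgM => //; exact: cvg_cst.
have ker r s : ccvg (fun n => kernel_integrand (pz (eps n) tau2 v) (qw (eps n) tau1 u)
    (r%:C * d) (s%:C * e)) (kernel_integrand (0, 1 / 3, - tau2, - v)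
    (0, - (1 / 3), tau1, u) (r%:C * d) (s%:C * e)).
  apply: ccvgM; last exact: ccvg_cst.
  by apply: ccvgM; apply: ccvg_exp; exact: ccvg_quartic.
have bi n r s : 0 < r -> 0 < s -> cnorm (kernel_integrand (pz (eps n) tau2 v)
    (qw (eps n) tau1 u) (r%:C * d) (s%:C * e) * e) <= K * cnorm e * halfpow r * halfpow s.
  move=> r0 s0; rewrite cnormM.
  have -> : K * cnorm e * halfpow r * halfpow s = K * halfpow r * halfpow s * cnorm e.
    by ring.
  by rewrite ler_wpM2r ?cnorm_ge0// bK.
have iH r := rintegrableZ (K * cnorm e * halfpow r) (@rintegrable_halfpow R).
have ii n r : 0 < r -> cintegrable (fun s => kernel_integrand (pz (eps n) tau2 v)
    (qw (eps n) tau1 u) (r%:C * d) (s%:C * e) * e).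
  move=> r0; apply: (cintegrable_dom _ (fun s => @bi n r s r0) (iH r)).
  apply: cmeasM; last exact: cmeas_cst.
  apply: cmeas_kernel; first exact: cmeas_cst.
  apply: cmeasM; last exact: cmeas_cst.
  by apply: cmeas_real; exact: measurable_id.
pose E := \int[mu]_(s in pos) halfpow s.
have inner r : 0 < r -> ccvg (fun n => ray_integral e (kernel_integrand
    (pz (eps n) tau2 v) (qw (eps n) tau1 u) (r%:C * d)))
    (ray_integral e (kernel_integrand (0, 1 / 3, - tau2, - v)
      (0, - (1 / 3), tau1, u) (r%:C * d))).
  move=> r0; apply: (cdominated_cvg _ _ _ (iH r)).
  - by move=> n; exact: ii.
  - by move=> s s0; apply: ccvgM; [exact: ker|exact: ccvg_cst].
  - by move=> n s s0; exact: bi.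
have iO := rintegrableZ (2 * (K * cnorm e) * E * cnorm d) (@rintegrable_halfpow R).
apply: (cdominated_cvg _ _ _ iO).
- move=> n; exact: (double_integral_swap c0 sep (tp n) (tq n)).1.
- by move=> r r0; apply: ccvgM; [exact: inner|exact: ccvg_cst].
- move=> n r r0; rewrite cnormM.
  have h := cnorm_cintegral (ii n r r0) (iH r) (fun s => @bi n r s r0).
  rewrite (RintegralZl _ (@measurable_pos R) (@rintegrable_halfpow R)) in h.
  have -> : 2 * (K * cnorm e) * E * cnorm d * halfpow r =
      2 * (K * cnorm e * halfpow r * E) * cnorm d by ring.
  by rewrite ler_wpM2r ?cnorm_ge0.
Qed.

End Limit.

(** * The contours as signed sums of rays *)

Section Contours.
Context {R : realType}.
Implicit Types (sg xi eta l h k : R) (p q : R * R * R * R) (d e : R[i]).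

Lemma cisE (t : R) : cis t = cos t +i* sin t.
Proof.
rewrite /cis /cexp creM cimM /= !(mul0r, mul1r, mulr0, subr0, sub0r, oppr0, addr0, add0r).
by rewrite expR0 mul1r.
Qed.

Lemma cos_pi4 : 0 < cos (pi / 4) :> R /\ sin (pi / 4) = cos (pi / 4) :> R.
Proof.
have p0 := pi_gt0 R; split.
  by apply: cos_gt0_pihalf; apply/andP; split; lra.
rewrite -cosBpihalf -cosN; congr cos; lra.
Qed.

(** Computing [cos (2 * pi / 3)] both as [- cos (pi / 3)] and by the addition formula gives a
    quadratic equation with roots 1/2 and -1; positivity excludes the latter. *)
Lemma cos_pi3 : cos (pi / 3) = 2^-1 :> R.
Proof.
have p0 := pi_gt0 R.
have c0 : 0 < cos (pi / 3) :> R by apply: cos_gt0_pihalf; apply/andP; split; lra.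
have e : cos (pi / 3 + pi / 3) = - cos (pi / 3) :> R.
  have -> : pi / 3 + pi / 3 = pi - pi / 3 :> R by lra.
  by rewrite cosB cospi sinpi mul0r addr0 mulN1r.
rewrite cosD -!expr2 in e; have := cos2Dsin2 (pi / 3 : R) => e2.
have : (2 * cos (pi / 3) - 1) * (cos (pi / 3) + 1) = 0 :> R by lra.
move=> /eqP; rewrite mulf_eq0 => /orP[] /eqP; lra.
Qed.

Lemma sin_pi3 : 0 < sin (pi / 3) :> R /\ sin (pi / 3) ^+ 2 = 3 / 4 :> R.
Proof.
have p0 := pi_gt0 R; split.
  by apply: sin_gt0_pihalf; apply/andP; split; lra.
have := cos2Dsin2 (pi / 3 : R); rewrite cos_pi3; lra.
Qed.

Lemma contour_imaginary_axis (g : R[i] -> R[i]) :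
  contour_integral (imaginary_axis R) g =
  ray_integral (0 +i* 1) g - ray_integral (0 +i* -1) g.
Proof.
have -> : 0 +i* (-1) = - 'i%C :> R[i] by apply: complexP => /=; rewrite ?oppr0.
rewrite /contour_integral /imaginary_axis !big_cons big_nil addr0.
exact: addrC.
Qed.

Lemma contour_airy_Sigma (g : R[i] -> R[i]) :
  contour_integral (airy_Sigma R) g =
  ray_integral (cis (pi / 3)) g - ray_integral (cis (- (pi / 3))) g.
Proof.
rewrite /contour_integral /airy_Sigma !big_cons big_nil addr0.
exact: addrC.
Qed.

(* Stated for variables, so that [ring] does not have to compare the (large)
   integrals these are applied to. *)
Lemma signed_sum4 (x1 x2 x3 x4 d : R[i]) :
  (x1 + (x2 + (- x3 + (- x4 + 0)))) * d = x1 * d - x3 * d + (x2 * d - x4 * d).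
Proof. by ring. Qed.

Lemma mulr_BDB (l x1 x2 x3 x4 : R[i]) :
  l * (x1 - x2 + (x3 - x4)) = l * x1 - l * x2 + (l * x3 - l * x4).
Proof. by ring. Qed.

Lemma signed_sum2 (x1 x2 d : R[i]) :
  (- x2 + (x1 + 0)) * d = x1 * d - x2 * d.
Proof. by ring. Qed.

(** The right pair, which vanishes in the limit, comes first; the left pair tends to the Airy
    contribution. *)
Definition pearcey_sum p q sg : R[i] :=
  double_integral p q (zdir sg 1) (wdir 1 (-1) 1)
  - double_integral p q (zdir sg 1) (wdir 1 1 1)
  + (double_integral p q (zdir sg 1) (wdir (-1) 1 1)
     - double_integral p q (zdir sg 1) (wdir (-1) (-1) 1)).

Lemma pearcey_contour p q l : p.1.1.1 < 0 -> 0 < q.1.1.1 -> 0 < l ->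
  contour_integral (imaginary_axis R) (fun z =>
    contour_integral (pearcey_Gamma R) (kernel_integrand p q z)) =
  l%:C * (pearcey_sum (rescale l p) (rescale l q) 1
          - pearcey_sum (rescale l p) (rescale l q) (-1)).
Proof.
move=> p4 q4 l0.
have h1 := @is_sign1 R.
have hN1 := @is_signN1 R.
have [k0 sc] := cos_pi4; set k := cos (pi / 4) in k0 sc.
have e1 : cis (- (pi / 4)) = wdir 1 (-1) k.
  by rewrite cisE cosN sinN sc /wdir mul1r mulN1r.
have e2 : - cis (- (pi / 4)) = wdir (-1) 1 k.
  by rewrite cisE cosN sinN sc; apply: complexP => /=; rewrite ?mul1r ?mulN1r ?opprK.
have e3 : cis (pi / 4) = wdir 1 1 k.
  by rewrite cisE sc /wdir !mul1r.
have e4 : - cis (pi / 4) = wdir (-1) (-1) k.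
  by rewrite cisE sc; apply: complexP => /=; rewrite mulN1r.
have key sg : is_sign sg -> ray_integral (0 +i* sg) (fun z =>
    contour_integral (pearcey_Gamma R) (kernel_integrand p q z)) =
    l%:C * pearcey_sum (rescale l p) (rescale l q) sg.
  move=> hs.
  have [i1 r1] := pearcey_pair hs h1 hN1 k0 l0 p4 q4.
  have [i2 r2] := pearcey_pair hs hN1 h1 k0 l0 p4 q4.
  have [i3 r3] := pearcey_pair hs h1 h1 k0 l0 p4 q4.
  have [i4 r4] := pearcey_pair hs hN1 hN1 k0 l0 p4 q4.
  rewrite /pearcey_sum; apply: etrans (esym (mulr_BDB _ _ _ _ _)).
  transitivity (double_integral p q (0 +i* sg) (wdir 1 (-1) k)
    - double_integral p q (0 +i* sg) (wdir 1 1 k)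
    + (double_integral p q (0 +i* sg) (wdir (-1) 1 k)
     - double_integral p q (0 +i* sg) (wdir (-1) (-1) k))); last first.
    exact: (f_equal2 +%R (f_equal2 (fun a b => a - b) r1 r3)
                         (f_equal2 (fun a b => a - b) r2 r4)).
  apply: etrans (cintegral_BDB i1 i3 i2 i4); apply: eq_cintegral => r r0.
  rewrite /contour_integral /pearcey_Gamma !big_cons big_nil e2 e4 e1 e3.
  exact: signed_sum4.
rewrite contour_imaginary_axis.
apply: etrans (f_equal2 (fun a b => a - b) (key 1 h1) (key (-1) hN1)) _.
by rewrite mulrBr.
Qed.

Lemma airy_contour (p3 p2 p1 q3 q2 q1 : R) : 0 < p3 -> q3 < 0 ->
  let p := (0, p3, p2, p1) in let q := (0, q3, q2, q1) in
  let S sg := double_integral p q (zdir sg 1) (wdir (-1) 1 1)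
     - double_integral p q (zdir sg 1) (wdir (-1) (-1) 1) in
  contour_integral (airy_Sigma R) (fun z =>
    contour_integral (airy_Gamma R) (kernel_integrand p q z)) = S 1 - S (-1).
Proof.
move=> p30 q30 p q S.
have h1 := @is_sign1 R.
have hN1 := @is_signN1 R.
have [h0 h2] := sin_pi3; have c3 := cos_pi3; set h := sin (pi / 3) in h0 h2.
have d1 : cis (pi / 3) = 2^-1 +i* (1 * h) :> R[i] by rewrite cisE c3 mul1r.
have d2 : cis (- (pi / 3)) = 2^-1 +i* (-1 * h) :> R[i].
  by rewrite cisE cosN sinN c3 mulN1r.
have p23 : 2 * pi / 3 = pi - pi / 3 :> R by lra.
have e1 : cis (2 * pi / 3) = (- 2^-1) +i* (1 * h) :> R[i].
  by rewrite cisE p23 cosB sinB cospi sinpi c3; apply: complexP => /=; rewrite -/h; field.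
have e2 : cis (- (2 * pi / 3)) = (- 2^-1) +i* (-1 * h) :> R[i].
  rewrite cisE cosN sinN p23 cosB sinB cospi sinpi c3.
  by apply: complexP => /=; rewrite -/h; field.
have key sg : is_sign sg -> ray_integral (2^-1 +i* (sg * h)) (fun z =>
    contour_integral (airy_Gamma R) (kernel_integrand p q z)) = S sg.
  move=> hs.
  have [i1 r1] := airy_pair p2 p1 q2 q1 hs h1 h0 h2 p30 q30.
  have [i2 r2] := airy_pair p2 p1 q2 q1 hs hN1 h0 h2 p30 q30.
  apply: etrans (f_equal2 (fun a b => a - b) r1 r2).
  apply: etrans (cintegralB i1 i2); apply: eq_cintegral => r r0.
  rewrite /contour_integral /airy_Gamma !big_cons big_nil e1 e2.
  exact: signed_sum2.
rewrite contour_airy_Sigma d1 d2.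
exact: (f_equal2 (fun a b => a - b) (key 1 h1) (key (-1) hN1)).
Qed.

End Contours.

(** * The kernels *)

Section Kernels.
Context {R : realType}.
Implicit Types (a b l tau u v : R) (z w : R[i]).

Lemma transition_integrand a tau1 tau2 u v z w :
  cexp (- (z ^+ 4 / 4) + a%:C * z ^+ 3 / 3
        - tau2%:C * z ^+ 2 / 2 - v%:C * z
        + w ^+ 4 / 4 - a%:C * w ^+ 3 / 3
        + tau1%:C * w ^+ 2 / 2 + u%:C * w) / (z - w) =
  kernel_integrand (- (1 / 4), a / 3, - (tau2 / 2), - v)
    (1 / 4, - (a / 3), tau1 / 2, u) z w.
Proof.
rewrite /kernel_integrand -cexpD; congr (cexp _ / _).
by rewrite /quartic /= !(rmorphN, rmorphM, fmorphV, rmorph1, rmorph_nat); field.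
Qed.

Lemma transition0_integrand tau1 tau2 u v z w :
  cexp (- (z ^+ 4 / 4) + 0%:C * z ^+ 3 / 3
        - tau2%:C * z ^+ 2 / 2 - v%:C * z
        + w ^+ 4 / 4 - 0%:C * w ^+ 3 / 3
        + tau1%:C * w ^+ 2 / 2 + u%:C * w) / (z - w) =
  cexp (- (z ^+ 4 / 4) - tau2%:C * z ^+ 2 / 2 - v%:C * z
        + w ^+ 4 / 4 + tau1%:C * w ^+ 2 / 2 + u%:C * w) / (z - w).
Proof. by rewrite rmorph0 !mul0r subr0 addr0. Qed.

Lemma airy_integrand tau1 tau2 u v z w :
  cexp (z ^+ 3 / 3 - z * v%:C - tau2%:C * z ^+ 2
        - w ^+ 3 / 3 + w * u%:C + tau1%:C * w ^+ 2) / (z - w) =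
  kernel_integrand (0, 1 / 3, - tau2, - v) (0, - (1 / 3), tau1, u) z w.
Proof.
rewrite /kernel_integrand -cexpD; congr (cexp _ / _).
by rewrite /quartic /= !(rmorphN, rmorphM, fmorphV, rmorph1, rmorph_nat, rmorph0); field.
Qed.

Lemma eq_contour_integral2 (g h : seq (oriented_ray R)) (F G : R[i] -> R[i] -> R[i]) :
  (forall z w, F z w = G z w) ->
  contour_integral g (fun z => contour_integral h (F z)) =
  contour_integral g (fun z => contour_integral h (G z)).
Proof.
by move=> FG; have -> : F = G by apply/funext => z; apply/funext => w.
Qed.

Definition gauss_term tau1 tau2 u v : R :=
  if tau1 > tau2 then
    expR (- ((u - v) ^+ 2 / (4 * (tau1 - tau2)))) / Num.sqrt (4 * pi * (tau1 - tau2))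
  else 0.

(** [b] stands for [a^(1/3)]. The variance scales by [b ^+ 2], so [b] cancels in the normalization
    and in the exponent. *)
Lemma gauss_term_scale b tau1 tau2 u v : 0 < b ->
  b * (if 2 * b ^+ 2 * tau1 > 2 * b ^+ 2 * tau2 then
       expR (- ((b * u - b * v) ^+ 2 / (2 * (2 * b ^+ 2 * tau1 - 2 * b ^+ 2 * tau2))))
         / Num.sqrt (2 * pi * (2 * b ^+ 2 * tau1 - 2 * b ^+ 2 * tau2))
     else 0) = gauss_term tau1 tau2 u v.
Proof.
move=> b0; rewrite /gauss_term ltr_pM2l ?mulr_gt0 ?exprn_gt0//.
case: ifPn => [t12|_]; last by rewrite mulr0.
have bn : b != 0 by rewrite gt_eqF.
have tn : tau1 - tau2 != 0 by rewrite subr_eq0 gt_eqF.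
have -> : 2 * b ^+ 2 * tau1 - 2 * b ^+ 2 * tau2 = 2 * b ^+ 2 * (tau1 - tau2) by ring.
have -> : 2 * pi * (2 * b ^+ 2 * (tau1 - tau2)) =
    b ^+ 2 * (4 * pi * (tau1 - tau2)) by ring.
rewrite sqrtrM ?exprn_ge0 ?(ltW b0)// sqrtr_sqr ger0_norm ?(ltW b0)//.
have -> : (b * u - b * v) ^+ 2 / (2 * (2 * b ^+ 2 * (tau1 - tau2))) =
    (u - v) ^+ 2 / (4 * (tau1 - tau2)).
  by move: (tau1 - tau2) tn => t tn; field; rewrite bn tn.
move: (Num.sqrt (4 * pi * (tau1 - tau2))) (expR _) => s e.
by rewrite invfM; move: s^-1 => s'; field.
Qed.

(** With [b = a^(1/3)] the rays are scaled by [l = b^-1], the prefactor [b] cancels the factor [l]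
    of the double integrals, and [eps] becomes [b^-1 ^+ 4]. *)
Lemma transition_kernel_scale b tau1 tau2 u v : 0 < b ->
  b%:C * transition_kernel (b ^+ 3) (2 * b ^+ 2 * tau1) (2 * b ^+ 2 * tau2)
    (b * u) (b * v) =
  ((2 * pi%:C * 'i%C) ^+ 2)^-1 *
    (pearcey_sum (pz (b^-1 ^+ 4) tau2 v) (qw (b^-1 ^+ 4) tau1 u) 1
     - pearcey_sum (pz (b^-1 ^+ 4) tau2 v) (qw (b^-1 ^+ 4) tau1 u) (-1))
  - (gauss_term tau1 tau2 u v)%:C.
Proof.
move=> b0; have bn : b != 0 by rewrite gt_eqF.
rewrite /transition_kernel.
rewrite (eq_contour_integral2 _ _ (transition_integrand _ _ _ _ _)).
rewrite (@pearcey_contour _ _ _ b^-1);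
  [|by rewrite /=; lra|by rewrite /=; lra|by rewrite invr_gt0].
have -> : rescale b^-1 (- (1 / 4), b ^+ 3 / 3, - (2 * b ^+ 2 * tau2 / 2), - (b * v)) =
    pz (b^-1 ^+ 4) tau2 v.
  by rewrite /rescale /pz /=; congr (_, _, _, _); field.
have -> : rescale b^-1 (1 / 4, - (b ^+ 3 / 3), 2 * b ^+ 2 * tau1 / 2, b * u) =
    qw (b^-1 ^+ 4) tau1 u.
  by rewrite /rescale /qw /=; congr (_, _, _, _); field.
rewrite -(gauss_term_scale _ _ _ _ b0) rmorphM mulrBr; congr (_ - _).
move: (pearcey_sum _ _ _ - _) => S.
rewrite mulrCA; congr (_ * _); rewrite mulrA -rmorphM divff//.
exact: mul1r.
Qed.

Lemma airy_kernelE tau1 tau2 u v :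
  let p := (0, 1 / 3, - tau2, - v) in let q := (0, - (1 / 3), tau1, u) in
  let S sg := double_integral p q (zdir sg 1) (wdir (-1) 1 1)
     - double_integral p q (zdir sg 1) (wdir (-1) (-1) 1) in
  airy_kernel tau1 tau2 u v =
  ((2 * pi%:C * 'i%C) ^+ 2)^-1 * (S 1 - S (-1)) - (gauss_term tau1 tau2 u v)%:C.
Proof.
move=> p q S; rewrite /airy_kernel.
rewrite (eq_contour_integral2 _ _ (airy_integrand _ _ _ _)).
by rewrite airy_contour//; lra.
Qed.

Lemma pearcey_sum_cvg sg tau1 tau2 u v (eps : nat -> R) : is_sign sg ->
  (forall n, 0 < eps n <= 1) -> eps n @[n --> \oo] --> 0 ->
  ccvg (fun n => pearcey_sum (pz (eps n) tau2 v) (qw (eps n) tau1 u) sg)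
    (double_integral (0, 1 / 3, - tau2, - v) (0, - (1 / 3), tau1, u)
      (zdir sg 1) (wdir (-1) 1 1)
     - double_integral (0, 1 / 3, - tau2, - v) (0, - (1 / 3), tau1, u)
      (zdir sg 1) (wdir (-1) (-1) 1)).
Proof.
move=> hs e01 e0.
have h1 := @is_sign1 R.
have hN1 := @is_signN1 R.
have epos n : 0 < eps n by have /andP[] := e01 n.
have [K hK] := right_contour_bound tau1 tau2 u v hs.
have Ke : K * eps n @[n --> \oo] --> 0.
  by rewrite -[X in _ --> X](mulr0 K); apply: cvgM => //; exact: cvg_cst.
have c1 := ccvg0_cnorm (fun n => hK _ (e01 n)) Ke.
have c2 := left_contour_cvg tau1 tau2 u v hs h1 epos e0.
have c3 := left_contour_cvg tau1 tau2 u v hs hN1 epos e0.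
have := ccvgD c1 (ccvgD c2 (ccvgN c3)).
by rewrite add0r.
Qed.

(** Dominated convergence speaks of sequences, so the limit at infinity is tested along sequences,
    separately for the real and imaginary parts. *)
Lemma cvgy_complex (f : R -> R[i]) (z : R[i]) :
  (forall x : nat -> R, x n @[n --> \oo] --> +oo -> ccvg (f \o x) z) ->
  f a @[a --> +oo] --> (z : R[i]^o).
Proof.
move=> h.
have hre : cre (f a) @[a --> +oo] --> cre z.
  by apply/cvg_pinftyP => x /h[].
have him : cim (f a) @[a --> +oo] --> cim z.
  by apply/cvg_pinftyP => x /h[].
(* The radius is an element of [R[i]]; being positive, it is real. *)
apply/(@cvgrPdist_lt _ R[i]^o) => -[e e']; rewrite ltcE /= => /andP[/eqP -> e0].
have e2 : 0 < e / 2 by lra.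
have nre := (cvgrPdist_lt _ _).1 hre _ e2.
have nim := (cvgrPdist_lt _ _).1 him _ e2.
near=> a.
have h1 : `|cre z - cre (f a)| < e / 2 by near: a; exact: nre.
have h2 : `|cim z - cim (f a)| < e / 2 by near: a; exact: nim.
rewrite -[`|_|]/((cnorm (z - f a))%:C) ltcR.
apply: (le_lt_trans (cnorm_le_re_im _)).
by rewrite creD creN cimD cimN; lra.
Unshelve. all: by end_near. Qed.

End Kernels.

Theorem proposition1p1 (R : realType) :
  @transition_kernel R 0 = @pearcey_kernel R
  /\
  forall u v tau1 tau2 : R,
    (a `^ (1 / 3))%:C *
      transition_kernel a
        (2 * a `^ (2 / 3) * tau1) (2 * a `^ (2 / 3) * tau2)
        (a `^ (1 / 3) * u) (a `^ (1 / 3) * v)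
      @[a --> +oo]
    --> (airy_kernel tau1 tau2 u v : R[i]^o).
Proof.
split.
  apply/funext => tau1; apply/funext => tau2; apply/funext => u; apply/funext => v.
  rewrite /transition_kernel.
  by rewrite (eq_contour_integral2 _ _ (transition0_integrand _ _ _ _)).
move=> u v tau1 tau2; apply: cvgy_complex => x xoo.
(* The maximum with 1 puts [eps n] in []0, 1]] for every [n], as the uniform bounds require; it
   agrees with [x n] eventually. *)
pose b n := (Num.max 1 (x n)) `^ (1 / 3).
have m1 n : 1 <= Num.max 1 (x n) by rewrite le_max lexx.
have b1 n : 1 <= b n.
  by have := @ge0_ler_powR R (1 / 3) _ 1 (Num.max 1 (x n)); rewrite powR1; apply;
    rewrite ?nnegrE//; have := m1 n; lra.
have b0 n : 0 < b n by apply: lt_le_trans (b1 n).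
have b3 n : b n ^+ 3 = Num.max 1 (x n).
  rewrite -powR_mulrn ?(ltW (b0 n))// -powRrM.
  by rewrite (_ : 1 / 3 * 3%:R = 1 :> R) ?powRr1//; [have := m1 n|]; lra.
pose eps n := (b n)^-1 ^+ 4.
have e01 n : 0 < eps n <= 1.
  rewrite exprn_gt0 ?invr_gt0//= exprn_ile1 ?invr_ge0 ?(ltW (b0 n))//.
  by rewrite invf_le1.
have e0 : eps n @[n --> \oo] --> 0.
  apply/cvgrPdist_lt => e epos; near=> n.
  have xe : e^-1 < x n by near: n; move/cvgryPgt : xoo; exact.
  rewrite sub0r normrN ger0_norm; last by have /andP[/ltW] := e01 n.
  have xm : x n <= Num.max 1 (x n) by rewrite le_max lexx orbT.
  have xp : 0 < x n by apply: lt_trans xe; rewrite invr_gt0.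
  (* One factor [(b n)^-1], which is at most 1, is dropped because the cube of [b n] is free of
     fractional powers. *)
  apply: (@le_lt_trans _ _ ((b n)^-1 ^+ 3)).
    by rewrite /eps exprS ler_piMl ?exprn_ge0 ?invr_ge0 ?(ltW (b0 n))// invf_le1.
  rewrite exprVn b3 -[ltRHS]invrK ltf_pV2 ?posrE ?invr_gt0//.
    exact: lt_le_trans xm.
  exact: lt_le_trans (m1 n).
have h1 := @is_sign1 R.
have hN1 := @is_signN1 R.
have c1 := pearcey_sum_cvg tau1 tau2 u v h1 e01 e0.
have cN1 := pearcey_sum_cvg tau1 tau2 u v hN1 e01 e0.
have := ccvgD (ccvgM (ccvg_cst ((2 * pi%:C * 'i%C) ^+ 2)^-1) (ccvgD c1 (ccvgN cN1)))
  (ccvg_cst (- (gauss_term tau1 tau2 u v)%:C)).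
rewrite -airy_kernelE => -[lre lim].
pose f a := (a `^ (1 / 3))%:C * transition_kernel a
        (2 * a `^ (2 / 3) * tau1) (2 * a `^ (2 / 3) * tau2)
        (a `^ (1 / 3) * u) (a `^ (1 / 3) * v).
have fE n : 1 <= x n -> f (x n) =
    ((2 * pi%:C * 'i%C) ^+ 2)^-1 *
    (pearcey_sum (pz (eps n) tau2 v) (qw (eps n) tau1 u) 1
     - pearcey_sum (pz (eps n) tau2 v) (qw (eps n) tau1 u) (-1))
    - (gauss_term tau1 tau2 u v)%:C.
  move=> x1; rewrite -transition_kernel_scale// b3.
  have xE : Num.max 1 (x n) = x n by apply/max_idPr.
  have -> : b n ^+ 2 = x n `^ (2 / 3).
    by rewrite -powR_mulrn ?(ltW (b0 n))// /b xE -powRrM; congr (_ `^ _); lra.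
  by rewrite /b xE.
have x1 : \forall n \near \oo, 1 <= x n by move/cvgryPge : xoo; exact.
split.
  apply: cvg_trans lre; apply: near_eq_cvg; near=> n.
  have xn : 1 <= x n by near: n; exact: x1.
  by rewrite -fE.
apply: cvg_trans lim; apply: near_eq_cvg; near=> n.
have xn : 1 <= x n by near: n; exact: x1.
by rewrite -fE.
Unshelve. all: by end_near. Qed.
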